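(* For every integer $n \geq 4$, $NFC(3,n) \leq n/2$.
   Context: A family $\mathcal{F}$ of finite sets is union-closed (UC) if $A \cup B \in \mathcal{F}$ for all $A,B \in \mathcal{F}$. Write $U(\mathcal{F})$ for the union of all members of $\mathcal{F}$, and $[n]=\{1,\dots,n\}$. For a family $\mathcal{S}$ of sets, $\langle \mathcal{S}\rangle$ (the family generated by $\mathcal{S}$) is the smallest UC family containing $\mathcal{S}$. A UC family $\mathcal{A}$ is Frankl-Complete (FC) if for every UC family $\mathcal{F} \supseteq \mathcal{A}$ there exists $i \in U(\mathcal{A})$ contained in at least $|\mathcal{F}|/2$ members of $\mathcal{F}$; otherwise $\mathcal{A}$ is Non-FC. A $k$-set is a set of cardinality $k$. For $n \geq 4$, $NFC(3,n)$ denotes the largest integer $k$ such that there exists a family $\mathcal{A} \subset 2^{[n]}$ of $k$ distinct 3-sets with $U(\mathcal{A})=[n]$ and $\langle \mathcal{A}\rangle$ Non-FC, and such that for every family $\mathcal{B}\subset 2^{[n]}$ of $k+1$ distinct 3-sets with $U(\mathcal{B})=[n]$, $\langle\mathcal{B}\rangle$ is FC. *)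

(* Defs.v *)
From mathcomp Require Import all_boot.
From mathcomp Require Import finmap.
Set Implicit Arguments. Unset Strict Implicit. Unset Printing Implicit Defensive.
Local Open Scope fset_scope.

Notation fam := {fset {fset nat}}.

Definition UC (F : fam) : Prop :=
  forall A B, A \in F -> B \in F -> A `|` B \in F.

Definition Ufam (F : fam) : {fset nat} := \bigcup_(S <- F) S.

Definition setn (n : nat) : {fset nat} := [fset i | i in iota 1 n].

(* <S>: smallest UC family containing S, i.e. the family of unions of
   nonempty subfamilies of S *)
Definition gen (S : fam) : fam :=
  [fset Ufam T | T in fpowerset S & T != fset0].

Definition FC (A : fam) : Prop :=
  forall F : fam, UC F -> A `<=` F ->
    exists2 i, i \in Ufam A & #|` F| <= 2 * #|` [fset X in F | i \in X]|.

Definition NFC_prop (r n k : nat) : Prop :=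
  (exists A : fam, [/\ #|` A| = k, (forall X, X \in A -> #|` X| = r),
      Ufam A = setn n & ~ FC (gen A)]) /\
  (forall B : fam, #|` B| = k.+1 -> (forall X, X \in B -> #|` X| = r) ->
      Ufam B = setn n -> FC (gen B)).

(* Main.v *)
Require Import Defs.
From mathcomp Require Import all_boot.
From mathcomp Require Import finmap.
From mathcomp Require Import zify.
From Stdlib Require Import NArith.

(* Following Poonen, 3-sets on a vertex set S generate an FC family as soon as some weights w satisfy
   the sum over X in B of (2 w(X) - w(S)) >= 0 for every union-closed B of subsets of S that is stable
   under adding the 3-sets: apply this to each fibre of F over the complement of S.
   Let x be the indicator of B.  If s and t both become u by adding 3-sets contained in u, then
   x(s) + x(t) <= x(s \/ t) + x(u), and for fourteen small hypergraphs the form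
   sum (2 w(X) - w(S)) x(X) is a nonnegative combination of these inequalities.
   Let A be a smallest family of 3-sets avoiding these hypergraphs with 2 |A| > |U(A)|.  Then no
   member of A has two private vertices (delete it), the degrees are at most 2 (the stars), and every
   member has a private vertex: otherwise its surroundings, followed for at most three steps, contain
   one of the hypergraphs.  Hence 4 |A| <= sum over y of (deg y + [deg y = 1]) <= 2 |U(A)|. *)

Set Implicit Arguments.
Unset Strict Implicit.
Unset Printing Implicit Defensive.

Local Open Scope fset_scope.
Local Open Scope nat_scope.

(** * Subsets as bit lists, linear forms as binary tries *)

Definition bunion (s t : seq bool) : seq bool := [seq p.1 || p.2 | p <- zip s t].
Definition bsub (s t : seq bool) : bool := all (fun p => p.1 ==> p.2) (zip s t).

Fixpoint bitlists (n : nat) : seq (seq bool) :=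
  if n is m.+1 then map (cons false) (bitlists m) ++ map (cons true) (bitlists m)
  else [:: [::]].

(** A linear form in unknowns x(s), for s a bit list of length n, is kept as a complete binary tree
    whose leaf at the end of the path s holds the coefficient of x(s). Adding a term costs n steps
    and comparing two forms costs one traversal, with binary coefficients throughout, which suits
    [vm_compute]. *)
Inductive trie := Leaf of N | Branch of trie & trie.

(** [insert] ignores surplus bits at a leaf and loses the term when the path is too short, so the
    facts about it carry this shape invariant. *)
Fixpoint perfect (n : nat) (t : trie) : bool :=
  match n, t with
  | 0, Leaf _ => true
  | m.+1, Branch l r => perfect m l && perfect m r
  | _, _ => false
  end.

Fixpoint insert (s : seq bool) (k : N) (t : trie) : trie :=
  match t, s with
  | Leaf a, _ => Leaf (a + k)%num
  | Branch l r, b :: s' => if b then Branch l (insert s' k r) else Branch (insert s' k l) r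
  | _, [::] => t
  end.

Fixpoint weigh (x : pred (seq bool)) (t : trie) : nat :=
  match t with
  | Leaf a => x [::] * N.to_nat a
  | Branch l r => weigh (fun s => x (false :: s)) l + weigh (fun s => x (true :: s)) r
  end.

(** The coefficient of x(s) is [a] plus the weight of s. With zero weights this is a constant form,
    so one function builds both sides of the weight inequality. *)
Fixpoint linear_trie (ws : seq N) (a : N) : trie :=
  if ws is w :: ws' then Branch (linear_trie ws' a) (linear_trie ws' (a + w)%num)
  else Leaf a.

Fixpoint trie_eqb (t u : trie) : bool :=
  match t, u with
  | Leaf a, Leaf b => N.eqb a b
  | Branch l r, Branch l' r' => trie_eqb l l' && trie_eqb r r'
  | _, _ => false
  end.

Definition dot (ws : seq nat) (s : seq bool) : nat := sumn (mask s ws).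

Lemma size_bunion n s t : size s = n -> size t = n -> size (bunion s t) = n.
Proof. by move=> hs ht; rewrite size_map size_zip hs ht minnn. Qed.

Lemma mem_bitlists n s : (s \in bitlists n) = (size s == n).
Proof.
elim: n s => [|n IH] [|b s] //=; rewrite mem_cat.
  by apply/norP; split; apply/mapP => -[].
have mem_cons c : (b :: s \in map (cons c) (bitlists n)) = (b == c) && (size s == n).
  apply/mapP/andP => [[u hu [-> ->]]|[/eqP-> hs]]; first by rewrite eqxx -IH.
  by exists s => //; rewrite IH.
by rewrite !mem_cons eqSS; case: (b) => /=; rewrite ?orbF.
Qed.

Lemma bitlists_uniq n : uniq (bitlists n).
Proof.
elim: n => //= n IH; rewrite cat_uniq !map_inj_uniq ?IH ?andbT => [|s t [] //|s t [] //].
by apply/hasPn => _ /mapP[s _ ->]; apply/mapP => -[].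
Qed.

Lemma insert_perfect n s k t : perfect n t -> perfect n (insert s k t).
Proof.
elim: n s t => [|n IH] [|b s] [a|l r] //= /andP[hl hr].
by case: b => /=; rewrite IH // ?hl ?hr.
Qed.

Lemma weigh_insert n s k t x : perfect n t -> size s = n ->
  weigh x (insert s k t) = weigh x t + x s * N.to_nat k.
Proof.
elim: n s t x => [|n IH] [|b s] [a|l r] x //=.
  by rewrite Nnat.N2Nat.inj_add mulnDr.
by move=> /andP[hl hr] [hs]; case: b => /=; rewrite IH // ?addnA // addnAC.
Qed.

Lemma weigh_linear ws a x :
  weigh x (linear_trie ws a) =
  \sum_(s <- bitlists (size ws) | x s) (N.to_nat a + dot (map N.to_nat ws) s).
Proof.
elim: ws a x => [|w ws IH] a x /=.
  by rewrite big_mkcond big_seq1 /dot /= addn0; case: (x _); rewrite ?mul1n.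
rewrite !IH big_cat !big_map; congr (_ + _); apply: eq_bigr => s _.
by rewrite /dot /= Nnat.N2Nat.inj_add addnA.
Qed.

Lemma linear_trie_perfect ws a : perfect (size ws) (linear_trie ws a).
Proof. by elim: ws a => //= w ws IH a; rewrite !IH. Qed.

Lemma trie_eqbP t u : trie_eqb t u -> t = u.
Proof.
elim: t u => [a|l IHl r IHr] [b|l' r'] //=; first by move/N.eqb_eq->.
by case/andP => /IHl-> /IHr->.
Qed.

(* Vertices are numbered from 0 and a set of vertices is encoded by the binary digits of a number.
   A term (s, t, u, k) stands for k times the inequality x(s) + x(t) <= x(s \/ t) + x(u); the images of
   the terms under the symmetries add up to [scale * size symmetries] times the weight form.
   The terms come from an exact solution of a linear program, found over orbits of the symmetries. *)
Record config := Config {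
  triples : seq (nat * nat * nat);
  weights : seq N;
  symmetries : seq (seq nat);
  scale : N;
  terms : seq (N * N * N * N) }.

Definition nverts (c : config) : nat := size (weights c).

(** * Inequalities between indicator values and the check of a certificate *)

Definition bits (n : nat) (k : N) : seq bool := [seq N.testbit k (N.of_nat i) | i <- iota 0 n].

Definition edge_bits (n : nat) (e : nat * nat * nat) : seq bool :=
  [seq i \in [:: e.1.1; e.1.2; e.2] | i <- iota 0 n].

Definition act (g : seq nat) (s : seq bool) : seq bool := map (nth false s) g.

(** Edges are tested against the fixed target [t], not against the growing set, so one pass adds to
    [s] all edges inside [t], whatever their order. *)
Definition grow (es : seq (seq bool)) (t s : seq bool) : seq bool :=
  foldr (fun e u => if bsub e t then bunion u e else u) s es.

Definition ineq : Type := (seq bool * seq bool * seq bool * N)%type.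

(** The two [grow] tests certify that x(s) and x(t) each imply x(u); when both hold, closure under
    unions also gives x of the union. The degenerate choice s = t amounts to x(s) <= x(u). *)
Definition sound_ineq (n : nat) (es : seq (seq bool)) (q : ineq) : bool :=
  let: (s, t, u, k) := q in
  [&& size s == n, size t == n, size u == n, grow es u s == u & grow es u t == u].

Definition add_lower (q : ineq) (t : trie) : trie :=
  let: (s, s', u, k) := q in insert s k (insert s' k t).

Definition add_upper (q : ineq) (t : trie) : trie :=
  let: (s, s', u, k) := q in insert (bunion s s') k (insert u k t).

Definition ineqs (c : config) : seq ineq :=
  [seq (act g (bits (nverts c) q.1.1.1), act g (bits (nverts c) q.1.1.2),
        act g (bits (nverts c) q.1.2), q.2) | g <- symmetries c, q <- terms c].

Definition weight_sum (ws : seq N) : N := foldr N.add 0%num ws.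

(** Negative coefficients are avoided by moving terms across: 2 d w(X) plus the left sides of all
    inequalities must equal d w(S) plus their right sides, coefficient by coefficient. Soundness is
    tested on every image under the symmetries. That each vertex lies in a triple and that the total
    weight is positive is what [FC_embeds] needs to conclude. *)
Definition verify (c : config) : bool :=
  let n := nverts c in
  let d := (scale c * N.of_nat (size (symmetries c)))%num in
  [&& all (sound_ineq n [seq edge_bits n e | e <- triples c]) (ineqs c),
      all (fun e => [&& e.1.1 < n, e.1.2 < n & e.2 < n]) (triples c),
      all (fun i => has (fun e => i \in [:: e.1.1; e.1.2; e.2]) (triples c)) (iota 0 n),
      (0 <? d)%num, (0 <? weight_sum (weights c))%num &
      trie_eqb
        (foldr add_lower (linear_trie [seq ((d + d) * w)%num | w <- weights c] 0) (ineqs c))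
        (foldr add_upper (linear_trie (nseq n 0%num) (d * weight_sum (weights c))) (ineqs c))].

Lemma grow_closed n es (x : pred (seq bool)) t s :
  (forall e u, e \in es -> size u = n -> x u -> x (bunion u e)) -> 
  (forall e, e \in es -> size e = n) -> size s = n -> x s -> x (grow es t s).
Proof.
move=> hx hes hs xs; suff [] : size (grow es t s) = n /\ x (grow es t s) by [].
elim: es hx hes => //= e es IH hx hes.
have [||hu xu] := IH; first by move=> f u hf; apply: hx; rewrite inE hf orbT.
  by move=> f hf; apply: hes; rewrite inE hf orbT.
case: ifP => // _; split; first by apply: size_bunion => //; rewrite hes ?mem_head.
by apply: hx; rewrite ?mem_head.
Qed.

Section Certificate.
Variables (n : nat) (es : seq (seq bool)) (x : pred (seq bool)).
Hypothesis size_es : forall e, e \in es -> size e = n.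
Hypothesis x_edge : forall e s, e \in es -> size s = n -> x s -> x (bunion s e).
Hypothesis x_union : forall s t, size s = n -> size t = n -> x s -> x t -> x (bunion s t).

Lemma add_perfect qs t : perfect n t ->
  perfect n (foldr add_lower t qs) && perfect n (foldr add_upper t qs).
Proof.
move=> ht; elim: qs => [|[[[s s'] u] k] qs /andP[h1 h2]] /=; first by rewrite ht.
by rewrite !insert_perfect.
Qed.

(** Every inequality adds at least as much to the upper side as to the lower side, so if the totals
    agree, the starting form [a] must make up for the difference. *)
Lemma weigh_add qs a b : perfect n a -> perfect n b -> all (sound_ineq n es) qs ->
  weigh x (foldr add_lower a qs) = weigh x (foldr add_upper b qs) -> weigh x b <= weigh x a.
Proof.
move=> pa pb hqs eq_ab.
(* A subtraction-free form of the comparison, which can be carried through the induction on [qs]. *)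
suff: weigh x (foldr add_lower a qs) + weigh x b <= weigh x (foldr add_upper b qs) + weigh x a.
  by rewrite eq_ab leq_add2l.
elim: qs hqs {eq_ab} => [_|[[[s t] u] k] qs IH] /=; first by rewrite addnC.
case/andP => /and5P[/eqP hs /eqP ht /eqP hu /eqP gs /eqP gt] {}/IH IH.
have /andP[p1 _] := add_perfect qs pa; have /andP[_ p2] := add_perfect qs pb.
rewrite !(@weigh_insert n) ?insert_perfect ?size_bunion //.
(* Adding edges preserves x, and by the soundness test this growth ends at u. *)
have xs : x s -> x u by move=> h; rewrite -gs; apply: (@grow_closed n).
have xt : x t -> x u by move=> h; rewrite -gt; apply: (@grow_closed n).
have: x s * N.to_nat k + x t * N.to_nat k <= x (bunion s t) * N.to_nat k + x u * N.to_nat k.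
  rewrite -!mulnDl leq_mul2r; apply/orP; right.
  case hxs: (x s); case hxt: (x t) => //.
  - by rewrite xs ?x_union.
  - by rewrite xs // leq_addl.
  - by rewrite xt // leq_addl.
  by move=> h; move: IH; lia.
exact: size_bunion.
Qed.
End Certificate.

Lemma size_edge_bits n e : size (edge_bits n e) = n.
Proof. by rewrite size_map size_iota. Qed.

(** Equality of the tries gives this inequality multiplied by d, the scale times the number of
    symmetries; d is positive and cancels. *)
Lemma verify_weigh c (x : pred (seq bool)) : verify c ->
  let n := nverts c in
  (forall e s, e \in triples c -> size s = n -> x s -> x (bunion s (edge_bits n e))) ->
  (forall s t, size s = n -> size t = n -> x s -> x t -> x (bunion s t)) ->
  \sum_(s <- bitlists n | x s) sumn (map N.to_nat (weights c)) <=
  \sum_(s <- bitlists n | x s) 2 * dot (map N.to_nat (weights c)) s.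
Proof.
case/and5P => sound _ _ d_gt0 /andP[_ /trie_eqbP eq_tries] n x_edge x_union.
move: (_ * _)%num d_gt0 eq_tries => d d_gt0 eq_tries.
have: weigh x (linear_trie (nseq n 0%num) (d * weight_sum (weights c))) <=
      weigh x (linear_trie [seq ((d + d) * w)%num | w <- weights c] 0).
  apply: (@weigh_add n [seq edge_bits n e | e <- triples c] x _ _ _ (ineqs c)) => //.
  - by move=> _ /mapP[e _ ->]; rewrite size_edge_bits.
  - by move=> _ s /mapP[e he ->]; apply: x_edge.
  - by have := linear_trie_perfect [seq ((d + d) * w)%num | w <- weights c] 0; rewrite size_map.
  - by have := linear_trie_perfect (nseq n 0%num) (d * weight_sum (weights c))%num; rewrite size_nseq.
  - by rewrite eq_tries.
rewrite !weigh_linear size_nseq size_map.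
have total_sumn : N.to_nat (weight_sum (weights c)) = sumn (map N.to_nat (weights c)).
  by elim: (weights c) => //= w ws <-; rewrite Nnat.N2Nat.inj_add.
have dot0 s : dot (map N.to_nat (nseq n 0%num)) s = 0.
  by rewrite /dot; elim: (n) s => [|m IH] [|[] s] //=; apply: IH.
have dotM s : dot [seq N.to_nat i | i <- [seq ((d + d) * w)%num | w <- weights c]] s =
    N.to_nat d * (2 * dot (map N.to_nat (weights c)) s).
  rewrite /dot; elim: (weights c) s => [|w ws IH] [|[] s] //=; rewrite ?muln0 //.
  by rewrite IH Nnat.N2Nat.inj_mul Nnat.N2Nat.inj_add !multE !plusE; lia.
under eq_bigr do rewrite dot0 addn0 Nnat.N2Nat.inj_mul total_sumn.
under [X in _ <= X]eq_bigr do rewrite dotM add0n.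
rewrite -!big_distrr /= leq_mul2l => /orP[/eqP d0|//].
by move: d_gt0; rewrite -[d]Nnat.N2Nat.id d0.
Qed.

(** * Bit lists placed on actual vertices *)

Definition realize (v : seq nat) (s : seq bool) : {fset nat} := seq_fset tt (mask s v).

Lemma in_realize v s y : (y \in realize v s) = (y \in mask s v).
Proof. exact: seq_fsetE. Qed.

Lemma realize_bunion v s t : size s = size v -> size t = size v ->
  realize v (bunion s t) = (realize v s `|` realize v t)%fset.
Proof.
move=> hs ht; apply/fsetP => y; rewrite inE !in_realize.
elim: v s t hs ht => [|a v IH] [|b s] [|b' t] //= [hs] [ht].
by case: b; case: b' => /=; rewrite ?inE IH //; case: (y == a); rewrite ?orbT.
Qed.

Lemma realize_edge v e :
  [&& e.1.1 < size v, e.1.2 < size v & e.2 < size v] ->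
  realize v (edge_bits (size v) e) =
  [fset nth 0 v e.1.1; nth 0 v e.1.2; nth 0 v e.2]%fset.
Proof.
case/and3P => h1 h2 h3; apply/fsetP => y.
have -> : edge_bits (size v) e = map (fun i => i \in [:: e.1.1; e.1.2; e.2]) (iota 0 (size v)) by [].
(* Writing [v] as a map over its positions turns the mask into a filter of those positions. *)
rewrite in_realize -{2}(mkseq_nth 0 v) /mkseq -map_mask -filter_mask !inE.
apply/mapP/idP => [[i]|].
  by rewrite mem_filter !inE => /andP[/or3P[]/eqP-> _ ->]; rewrite eqxx ?orbT.
by case/orP => [/orP[]|] /eqP->; eexists; try reflexivity;
  rewrite mem_filter mem_iota !inE eqxx ?orbT ?h1 ?h2 ?h3.
Qed.

Definition trace (v : seq nat) (X : {fset nat}) : seq bool := [seq y \in X | y <- v].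

Lemma trace_realize v Y s : uniq v -> size s = size v -> (forall y, y \in v -> y \notin Y) ->
  trace v (Y `|` realize v s)%fset = s.
Proof.
move=> uv hs disj; apply: (@eq_from_nth _ false); rewrite size_map // => i hi.
rewrite (nth_map 0) // inE (negbTE (disj _ _)) ?mem_nth //= in_realize.
elim: v s i uv hs hi {disj} => // a v IH [|b s] //= [|i] /andP[ha uv] [hs] hi /=.
  case: b; first by rewrite mem_head.
  by apply: contraNF ha; apply: mem_mask.
rewrite -IH //; case: b => //; rewrite inE; case: eqP => // eq_a.
by rewrite -eq_a mem_nth in ha.
Qed.

Lemma realize_trace v X : realize v (trace v X) = [fset y in X | y \in v]%fset.
Proof.
apply/fsetP => y; rewrite in_realize /trace -filter_mask mem_filter !inE.
by rewrite andbC andbC.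
Qed.

Lemma UfamP (A : fam) y : reflect (exists2 X, X \in A & y \in X) (y \in Ufam A).
Proof.
apply: (iffP (bigfcupP _ _ _ _)) => [[X /andP[XA _] yX]|[X XA yX]]; exists X => //.
by rewrite XA.
Qed.

Lemma gen_sub (A : fam) X : X \in A -> X \in gen A.
Proof.
move=> XA; apply/imfsetP; exists [fset X]%fset; last by rewrite /Ufam big_seq_fset1.
rewrite !inE fpowersetE fsub1set XA /=.
by apply/fset0Pn; exists X; rewrite inE.
Qed.

(** * Fibres over the complement of the vertices *)

Definition rest (v : seq nat) (X : {fset nat}) : {fset nat} := [fset y in X | y \notin v]%fset.

(** Members of F are grouped by their part Y outside [v]. Within a group a member is determined by
    its trace on [v], so the group is indexed by the bit lists that land in F. *)
Lemma fiber_sum (f : seq bool -> nat) (F : fam) v : uniq v ->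
  let K := [fset rest v X | X in F]%fset in
  \sum_(X <- F) f (trace v X) =
  \sum_(Y <- K) \sum_(s <- bitlists (size v) | (Y `|` realize v s)%fset \in F) f s.
Proof.
move=> uv K; pose out := rest v.
have eq_fiber Y : Y \in K ->
    \sum_(s <- bitlists (size v) | (Y `|` realize v s)%fset \in F) f s =
    \sum_(X <- F | out X == Y) f (trace v X).
  case/imfsetP => X0 _ defY.
  have disj y : y \in v -> y \notin Y by rewrite defY !inE => ->; rewrite andbF.
  pose r := [seq s <- bitlists (size v) | (Y `|` realize v s)%fset \in F].
  have trK s : s \in r -> trace v (Y `|` realize v s)%fset = s.
    by rewrite mem_filter mem_bitlists => /andP[_ /eqP hs]; apply: trace_realize.
  have outK s : out (Y `|` realize v s)%fset = Y.
    apply/fsetP => y; rewrite !inE in_realize; case yv: (y \in v).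
      by rewrite andbF (negbTE (disj _ yv)).
    by rewrite andbT (contraFF (@mem_mask _ _ _ _) yv) orbF.
  have inj_r : {in r &, injective (fun s => Y `|` realize v s)%fset}.
    by move=> s t /trK {2}<- /trK {2}<- ->.
  rewrite -big_filter -[RHS]big_filter -/r.
  (* The fibre over Y is, up to order, the injective image of the admissible bit lists. *)
  rewrite (perm_big (map (fun s => Y `|` realize v s)%fset r)); last first.
    apply: uniq_perm; first by rewrite filter_uniq ?fset_uniq.
      by rewrite map_inj_in_uniq // filter_uniq // bitlists_uniq.
    move=> X; rewrite mem_filter; apply/andP/mapP => [[/eqP outX XF]|[s]].
      have defX : X = (Y `|` realize v (trace v X))%fset.
        apply/fsetP => y; rewrite realize_trace -outX !inE.
        by case: (y \in X); case: (y \in v).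
      by exists (trace v X); rewrite // mem_filter -defX XF mem_bitlists size_map eqxx.
    by rewrite mem_filter => /andP[sF _] ->; rewrite outK.
  by rewrite big_map !big_seq; apply: eq_bigr => s /trK ->.
rewrite [RHS]big_seq (eq_bigr _ eq_fiber) -big_seq.
(* After the exchange, each X is counted for the single index Y = [out X]. *)
rewrite (exchange_big_dep xpredT) //=; apply: eq_big_seq => X XF.
have outX : out X \in K by apply/imfsetP; exists X.
rewrite big_mkcond /= (bigD1_seq (out X)) ?fset_uniq //= eqxx big1 ?addn0 // => Y.
by rewrite eq_sym => /negbTE ->.
Qed.

(** * The fourteen hypergraphs *)

(** Removing vertex 0 from a star leaves a graph with three edges. The five stars realize all such
    graphs without isolated vertices: triangle, claw, path, two-edge path plus an edge, and
    matching, in this order. *)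
Definition star4 : config := Config
  [:: (0, 1, 2); (0, 1, 3); (0, 2, 3)]
  [:: 1; 1; 1; 1]%num
  [::
     [:: 0; 1; 2; 3]; [:: 0; 1; 3; 2]; [:: 0; 2; 1; 3]; [:: 0; 2; 3; 1];
     [:: 0; 3; 1; 2]; [:: 0; 3; 2; 1]]
  1%num
  [::
     (0, 0, 7, 4); (6, 8, 15, 2); (2, 8, 15, 2); (1, 1, 7, 2)]%num.

Definition star5_common_pair : config := Config
  [:: (0, 1, 2); (0, 1, 3); (0, 1, 4)]
  [:: 3; 3; 2; 2; 2]%num
  [::
     [:: 0; 1; 2; 3; 4]; [:: 0; 1; 2; 4; 3]; [:: 0; 1; 3; 2; 4];
     [:: 0; 1; 3; 4; 2]; [:: 0; 1; 4; 2; 3]; [:: 0; 1; 4; 3; 2];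
     [:: 1; 0; 2; 3; 4]; [:: 1; 0; 2; 4; 3]; [:: 1; 0; 3; 2; 4];
     [:: 1; 0; 3; 4; 2]; [:: 1; 0; 4; 2; 3]; [:: 1; 0; 4; 3; 2]]
  1%num
  [::
     (0, 0, 7, 12); (7, 7, 15, 12); (12, 18, 31, 12); (5, 16, 23, 12);
     (2, 4, 7, 12)]%num.

Definition star5 : config := Config
  [:: (0, 1, 2); (0, 1, 3); (0, 2, 4)]
  [:: 4; 3; 3; 2; 2]%num
  [::
     [:: 0; 1; 2; 3; 4]; [:: 0; 2; 1; 4; 3]]
  1%num
  [::
     (0, 0, 11, 8); (8, 8, 15, 4); (8, 8, 29, 16); (2, 12, 15, 4);
     (6, 24, 31, 2); (4, 9, 31, 4); (1, 24, 31, 2); (24, 24, 31, 2);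
     (10, 20, 31, 4); (1, 12, 15, 4); (2, 2, 23, 8); (0, 0, 7, 6)]%num.

Definition star6 : config := Config
  [:: (0, 1, 2); (0, 1, 3); (0, 4, 5)]
  [:: 10; 8; 5; 5; 5; 5]%num
  [::
     [:: 0; 1; 2; 3; 4; 5]; [:: 0; 1; 2; 3; 5; 4]; [:: 0; 1; 3; 2; 4; 5];
     [:: 0; 1; 3; 2; 5; 4]]
  1%num
  [::
     (8, 52, 63, 2); (18, 20, 23, 8); (16, 16, 23, 56); (0, 0, 49, 18);
     (4, 8, 15, 2); (12, 12, 61, 20); (22, 24, 31, 16); (2, 4, 7, 6);
     (10, 52, 63, 14); (0, 0, 7, 20); (8, 50, 59, 2); (9, 20, 63, 8);
     (2, 2, 51, 16); (14, 48, 63, 4); (7, 7, 15, 12); (4, 4, 53, 36);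
     (49, 49, 55, 16); (1, 4, 7, 2); (53, 57, 63, 2); (6, 8, 15, 2);
     (9, 28, 63, 8); (3, 3, 51, 2); (5, 8, 15, 2); (17, 28, 31, 8);
     (17, 20, 23, 8); (1, 18, 59, 16); (53, 53, 55, 8); (10, 48, 59, 14);
     (20, 20, 31, 32)]%num.

Definition star7 : config := Config
  [:: (0, 1, 2); (0, 3, 4); (0, 5, 6)]
  [:: 2; 1; 1; 1; 1; 1; 1]%num
  [::
     [:: 0; 1; 2; 3; 4; 5; 6]; [:: 0; 1; 2; 3; 4; 6; 5];
     [:: 0; 1; 2; 4; 3; 5; 6]; [:: 0; 1; 2; 4; 3; 6; 5];
     [:: 0; 1; 2; 5; 6; 3; 4]; [:: 0; 1; 2; 5; 6; 4; 3];
     [:: 0; 1; 2; 6; 5; 3; 4]; [:: 0; 1; 2; 6; 5; 4; 3];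
     [:: 0; 2; 1; 3; 4; 5; 6]; [:: 0; 2; 1; 3; 4; 6; 5];
     [:: 0; 2; 1; 4; 3; 5; 6]; [:: 0; 2; 1; 4; 3; 6; 5];
     [:: 0; 2; 1; 5; 6; 3; 4]; [:: 0; 2; 1; 5; 6; 4; 3];
     [:: 0; 2; 1; 6; 5; 3; 4]; [:: 0; 2; 1; 6; 5; 4; 3];
     [:: 0; 3; 4; 1; 2; 5; 6]; [:: 0; 3; 4; 1; 2; 6; 5];
     [:: 0; 3; 4; 2; 1; 5; 6]; [:: 0; 3; 4; 2; 1; 6; 5];
     [:: 0; 3; 4; 5; 6; 1; 2]; [:: 0; 3; 4; 5; 6; 2; 1];
     [:: 0; 3; 4; 6; 5; 1; 2]; [:: 0; 3; 4; 6; 5; 2; 1];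
     [:: 0; 4; 3; 1; 2; 5; 6]; [:: 0; 4; 3; 1; 2; 6; 5];
     [:: 0; 4; 3; 2; 1; 5; 6]; [:: 0; 4; 3; 2; 1; 6; 5];
     [:: 0; 4; 3; 5; 6; 1; 2]; [:: 0; 4; 3; 5; 6; 2; 1];
     [:: 0; 4; 3; 6; 5; 1; 2]; [:: 0; 4; 3; 6; 5; 2; 1];
     [:: 0; 5; 6; 1; 2; 3; 4]; [:: 0; 5; 6; 1; 2; 4; 3];
     [:: 0; 5; 6; 2; 1; 3; 4]; [:: 0; 5; 6; 2; 1; 4; 3];
     [:: 0; 5; 6; 3; 4; 1; 2]; [:: 0; 5; 6; 3; 4; 2; 1];
     [:: 0; 5; 6; 4; 3; 1; 2]; [:: 0; 5; 6; 4; 3; 2; 1];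
     [:: 0; 6; 5; 1; 2; 3; 4]; [:: 0; 6; 5; 1; 2; 4; 3];
     [:: 0; 6; 5; 2; 1; 3; 4]; [:: 0; 6; 5; 2; 1; 4; 3];
     [:: 0; 6; 5; 3; 4; 1; 2]; [:: 0; 6; 5; 3; 4; 2; 1];
     [:: 0; 6; 5; 4; 3; 1; 2]; [:: 0; 6; 5; 4; 3; 2; 1]]
  1%num
  [::
     (0, 0, 7, 8); (10, 10, 107, 48); (15, 15, 111, 12); (7, 7, 31, 8);
     (33, 42, 63, 12); (2, 2, 27, 36); (6, 96, 103, 4); (1, 42, 127, 4);
     (14, 104, 111, 12); (30, 96, 127, 4)]%num.

Definition loose_triangle : config := Config
  [:: (0, 1, 2); (2, 3, 4); (4, 5, 0)]
  [:: 2; 1; 2; 1; 2; 1]%num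
  [::
     [:: 0; 1; 2; 3; 4; 5]; [:: 0; 5; 4; 3; 2; 1]; [:: 2; 1; 0; 5; 4; 3];
     [:: 2; 3; 4; 5; 0; 1]; [:: 4; 3; 2; 1; 0; 5]; [:: 4; 5; 0; 1; 2; 3]]
  1%num
  [::
     (1, 1, 29, 12); (0, 0, 7, 9); (7, 7, 31, 12); (14, 32, 63, 3);
     (2, 2, 7, 6); (9, 9, 29, 3); (9, 24, 61, 6); (2, 2, 30, 12);
     (3, 24, 63, 6); (10, 10, 15, 6); (5, 16, 61, 3); (42, 42, 47, 3);
     (11, 26, 59, 3); (10, 10, 59, 9)]%num.

(** In this configuration and the next three, two triples share the pair 0, 1 and their free
    vertices 2 and 3 are both covered again: by one triple, or by two triples with two, one or no
    common vertices. *)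
Definition pair_bridge : config := Config
  [:: (0, 1, 2); (0, 1, 3); (2, 3, 4)]
  [:: 2; 2; 3; 3; 2]%num
  [::
     [:: 0; 1; 2; 3; 4]; [:: 0; 1; 3; 2; 4]; [:: 1; 0; 2; 3; 4];
     [:: 1; 0; 3; 2; 4]]
  1%num
  [::
     (0, 0, 7, 8); (5, 8, 15, 8); (16, 16, 23, 8); (1, 1, 29, 16);
     (7, 7, 15, 4); (0, 0, 28, 4); (15, 15, 31, 4); (3, 3, 31, 4);
     (18, 20, 23, 4); (8, 17, 31, 4)]%num.

Definition pair_pair : config := Config
  [:: (0, 1, 2); (0, 1, 3); (2, 4, 5); (3, 4, 5)]
  [:: 1; 1; 1; 1; 1; 1]%num
  [::
     [:: 0; 1; 2; 3; 4; 5]; [:: 0; 1; 2; 3; 5; 4]; [:: 0; 1; 3; 2; 4; 5];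
     [:: 0; 1; 3; 2; 5; 4]; [:: 1; 0; 2; 3; 4; 5]; [:: 1; 0; 2; 3; 5; 4];
     [:: 1; 0; 3; 2; 4; 5]; [:: 1; 0; 3; 2; 5; 4]; [:: 4; 5; 2; 3; 0; 1];
     [:: 4; 5; 2; 3; 1; 0]; [:: 4; 5; 3; 2; 0; 1]; [:: 4; 5; 3; 2; 1; 0];
     [:: 5; 4; 2; 3; 0; 1]; [:: 5; 4; 2; 3; 1; 0]; [:: 5; 4; 3; 2; 0; 1];
     [:: 5; 4; 3; 2; 1; 0]]
  1%num
  [::
     (0, 0, 7, 6); (7, 7, 15, 4); (21, 24, 31, 6); (1, 1, 53, 16);
     (4, 4, 7, 8); (3, 48, 63, 2); (12, 17, 63, 2); (5, 5, 61, 4);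
     (17, 24, 31, 6); (7, 7, 55, 10); (55, 55, 63, 2)]%num.

Definition pair_wedge : config := Config
  [:: (0, 1, 2); (0, 1, 3); (2, 4, 5); (3, 4, 6)]
  [:: 2; 2; 2; 2; 2; 1; 1]%num
  [::
     [:: 0; 1; 2; 3; 4; 5; 6]; [:: 0; 1; 3; 2; 4; 6; 5];
     [:: 1; 0; 2; 3; 4; 5; 6]; [:: 1; 0; 3; 2; 4; 6; 5]]
  3%num
  [::
     (109, 109, 125, 2); (3, 112, 127, 12); (106, 108, 111, 8);
     (52, 52, 63, 12); (16, 16, 23, 24); (20, 24, 31, 12); (48, 48, 59, 24);
     (96, 96, 103, 24); (5, 5, 93, 48); (38, 40, 47, 12); (7, 7, 15, 12);
     (4, 4, 92, 24); (0, 0, 52, 24); (97, 97, 117, 16); (52, 52, 55, 36);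
     (4, 4, 52, 24); (117, 117, 125, 40); (32, 32, 43, 48);
     (103, 103, 111, 8); (37, 72, 127, 12); (54, 60, 127, 12);
     (32, 32, 39, 12); (2, 44, 63, 12); (0, 0, 7, 12); (1, 1, 53, 36);
     (100, 104, 111, 8); (33, 33, 121, 72); (36, 36, 47, 24);
     (35, 48, 123, 12); (56, 56, 59, 12); (98, 100, 103, 8); (12, 17, 95, 12);
     (41, 69, 125, 6); (52, 52, 124, 12); (18, 28, 31, 12); (43, 43, 123, 36);
     (41, 41, 61, 12); (40, 49, 63, 24)]%num.

Definition pair_two_pendants : config := Config
  [:: (0, 1, 2); (0, 1, 3); (2, 4, 5); (3, 6, 7)]
  [:: 2; 2; 2; 2; 1; 1; 1; 1]%num
  [::
     [:: 0; 1; 2; 3; 4; 5; 6; 7]; [:: 0; 1; 2; 3; 4; 5; 7; 6];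
     [:: 0; 1; 2; 3; 5; 4; 6; 7]; [:: 0; 1; 2; 3; 5; 4; 7; 6];
     [:: 0; 1; 3; 2; 6; 7; 4; 5]; [:: 0; 1; 3; 2; 6; 7; 5; 4];
     [:: 0; 1; 3; 2; 7; 6; 4; 5]; [:: 0; 1; 3; 2; 7; 6; 5; 4];
     [:: 1; 0; 2; 3; 4; 5; 6; 7]; [:: 1; 0; 2; 3; 4; 5; 7; 6];
     [:: 1; 0; 2; 3; 5; 4; 6; 7]; [:: 1; 0; 2; 3; 5; 4; 7; 6];
     [:: 1; 0; 3; 2; 6; 7; 4; 5]; [:: 1; 0; 3; 2; 6; 7; 5; 4];
     [:: 1; 0; 3; 2; 7; 6; 4; 5]; [:: 1; 0; 3; 2; 7; 6; 5; 4]]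
  1%num
  [::
     (80, 80, 87, 32); (52, 52, 252, 4); (48, 48, 59, 16); (67, 112, 119, 8);
     (1, 1, 53, 4); (4, 24, 252, 8); (20, 20, 220, 24); (0, 0, 52, 12);
     (114, 120, 123, 8); (22, 24, 31, 4); (59, 59, 251, 8); (68, 81, 119, 4);
     (27, 27, 31, 20); (52, 52, 63, 8); (118, 124, 127, 32);
     (56, 113, 251, 8); (252, 252, 255, 8); (7, 7, 207, 4); (84, 88, 95, 4);
     (5, 5, 205, 12); (2, 12, 207, 4); (28, 84, 220, 16); (52, 52, 55, 8);
     (5, 25, 253, 12); (16, 16, 23, 8); (2, 4, 7, 8); (3, 240, 255, 4);
     (16, 16, 216, 4); (112, 112, 123, 16); (7, 7, 15, 4); (53, 53, 253, 4);
     (116, 116, 119, 12); (49, 49, 249, 16); (21, 21, 221, 12);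
     (13, 25, 61, 4); (82, 92, 95, 28); (24, 84, 223, 8); (17, 17, 217, 48);
     (29, 85, 221, 4); (16, 16, 27, 28)]%num.

Definition spider : config := Config
  [:: (0, 1, 2); (0, 3, 4); (1, 5, 6); (2, 7, 8)]
  [:: 2; 2; 2; 1; 1; 1; 1; 1; 1]%num
  [::
     [:: 0; 1; 2; 3; 4; 5; 6; 7; 8]; [:: 0; 1; 2; 3; 4; 5; 6; 8; 7];
     [:: 0; 1; 2; 3; 4; 6; 5; 7; 8]; [:: 0; 1; 2; 3; 4; 6; 5; 8; 7];
     [:: 0; 1; 2; 4; 3; 5; 6; 7; 8]; [:: 0; 1; 2; 4; 3; 5; 6; 8; 7];
     [:: 0; 1; 2; 4; 3; 6; 5; 7; 8]; [:: 0; 1; 2; 4; 3; 6; 5; 8; 7];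
     [:: 0; 2; 1; 3; 4; 7; 8; 5; 6]; [:: 0; 2; 1; 3; 4; 7; 8; 6; 5];
     [:: 0; 2; 1; 3; 4; 8; 7; 5; 6]; [:: 0; 2; 1; 3; 4; 8; 7; 6; 5];
     [:: 0; 2; 1; 4; 3; 7; 8; 5; 6]; [:: 0; 2; 1; 4; 3; 7; 8; 6; 5];
     [:: 0; 2; 1; 4; 3; 8; 7; 5; 6]; [:: 0; 2; 1; 4; 3; 8; 7; 6; 5];
     [:: 1; 0; 2; 5; 6; 3; 4; 7; 8]; [:: 1; 0; 2; 5; 6; 3; 4; 8; 7];
     [:: 1; 0; 2; 5; 6; 4; 3; 7; 8]; [:: 1; 0; 2; 5; 6; 4; 3; 8; 7];
     [:: 1; 0; 2; 6; 5; 3; 4; 7; 8]; [:: 1; 0; 2; 6; 5; 3; 4; 8; 7];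
     [:: 1; 0; 2; 6; 5; 4; 3; 7; 8]; [:: 1; 0; 2; 6; 5; 4; 3; 8; 7];
     [:: 1; 2; 0; 5; 6; 7; 8; 3; 4]; [:: 1; 2; 0; 5; 6; 7; 8; 4; 3];
     [:: 1; 2; 0; 5; 6; 8; 7; 3; 4]; [:: 1; 2; 0; 5; 6; 8; 7; 4; 3];
     [:: 1; 2; 0; 6; 5; 7; 8; 3; 4]; [:: 1; 2; 0; 6; 5; 7; 8; 4; 3];
     [:: 1; 2; 0; 6; 5; 8; 7; 3; 4]; [:: 1; 2; 0; 6; 5; 8; 7; 4; 3];
     [:: 2; 0; 1; 7; 8; 3; 4; 5; 6]; [:: 2; 0; 1; 7; 8; 3; 4; 6; 5];
     [:: 2; 0; 1; 7; 8; 4; 3; 5; 6]; [:: 2; 0; 1; 7; 8; 4; 3; 6; 5];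
     [:: 2; 0; 1; 8; 7; 3; 4; 5; 6]; [:: 2; 0; 1; 8; 7; 3; 4; 6; 5];
     [:: 2; 0; 1; 8; 7; 4; 3; 5; 6]; [:: 2; 0; 1; 8; 7; 4; 3; 6; 5];
     [:: 2; 1; 0; 7; 8; 5; 6; 3; 4]; [:: 2; 1; 0; 7; 8; 5; 6; 4; 3];
     [:: 2; 1; 0; 7; 8; 6; 5; 3; 4]; [:: 2; 1; 0; 7; 8; 6; 5; 4; 3];
     [:: 2; 1; 0; 8; 7; 5; 6; 3; 4]; [:: 2; 1; 0; 8; 7; 5; 6; 4; 3];
     [:: 2; 1; 0; 8; 7; 6; 5; 3; 4]; [:: 2; 1; 0; 8; 7; 6; 5; 4; 3]]
  1%num
  [::
     (120, 120, 508, 12); (130, 184, 255, 12); (36, 186, 447, 36);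
     (168, 168, 175, 48); (10, 10, 398, 12); (139, 169, 235, 12);
     (40, 40, 47, 96); (7, 7, 31, 12); (25, 25, 123, 12); (30, 60, 126, 12);
     (8, 8, 15, 48); (9, 9, 107, 12); (138, 169, 239, 36); (11, 41, 107, 12);
     (36, 56, 63, 12); (34, 56, 63, 24); (41, 41, 429, 84); (57, 57, 445, 36);
     (37, 44, 61, 12); (0, 0, 7, 12); (154, 184, 250, 24); (15, 15, 111, 36);
     (47, 47, 431, 48); (58, 58, 446, 48); (56, 56, 444, 24);
     (31, 31, 127, 24); (4, 24, 31, 12); (125, 249, 509, 24);
     (26, 26, 414, 36); (8, 8, 106, 12); (4, 248, 511, 12); (6, 24, 31, 12);
     (166, 184, 191, 12); (38, 56, 447, 12)]%num.

(** In the last three configurations a path of triples leaves a couple of triples sharing 0, 1 at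
    the vertex 2, while 3 stays free. The path runs into a second couple at once, or after one
    linking triple, or goes on for three triples. *)
Definition dumbbell0 : config := Config
  [:: (0, 1, 2); (0, 1, 3); (2, 4, 5); (4, 5, 6)]
  [:: 3; 3; 4; 2; 3; 3; 2]%num
  [::
     [:: 0; 1; 2; 3; 4; 5; 6]; [:: 0; 1; 2; 3; 5; 4; 6];
     [:: 1; 0; 2; 3; 4; 5; 6]; [:: 1; 0; 2; 3; 5; 4; 6];
     [:: 4; 5; 2; 6; 0; 1; 3]; [:: 4; 5; 2; 6; 1; 0; 3];
     [:: 5; 4; 2; 6; 0; 1; 3]; [:: 5; 4; 2; 6; 1; 0; 3]]
  1%num
  [::
     (4, 72, 127, 10); (41, 73, 121, 2); (18, 24, 27, 2); (7, 7, 55, 12);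
     (3, 48, 119, 4); (8, 8, 120, 22); (66, 72, 75, 2); (11, 11, 63, 8);
     (18, 28, 31, 8); (1, 1, 53, 2); (66, 76, 79, 14); (0, 0, 11, 8);
     (11, 11, 15, 8); (6, 8, 63, 2); (41, 73, 125, 24); (22, 24, 31, 22);
     (9, 9, 61, 40); (0, 0, 7, 12); (2, 12, 63, 16); (3, 3, 115, 8);
     (1, 1, 113, 38); (27, 27, 31, 10); (17, 20, 23, 22); (41, 77, 125, 6);
     (43, 75, 127, 10); (50, 56, 59, 8); (8, 8, 60, 8); (4, 25, 63, 2);
     (43, 75, 123, 12); (75, 75, 79, 2); (84, 89, 95, 26)]%num.

Definition dumbbell1 : config := Config
  [:: (0, 1, 2); (0, 1, 3); (2, 4, 5); (5, 6, 7); (6, 7, 8)]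
  [:: 2; 2; 3; 1; 2; 3; 2; 2; 1]%num
  [::
     [:: 0; 1; 2; 3; 4; 5; 6; 7; 8]; [:: 0; 1; 2; 3; 4; 5; 7; 6; 8];
     [:: 1; 0; 2; 3; 4; 5; 6; 7; 8]; [:: 1; 0; 2; 3; 4; 5; 7; 6; 8];
     [:: 6; 7; 5; 8; 4; 2; 0; 1; 3]; [:: 6; 7; 5; 8; 4; 2; 1; 0; 3];
     [:: 7; 6; 5; 8; 4; 2; 0; 1; 3]; [:: 7; 6; 5; 8; 4; 2; 1; 0; 3]]
  436%num
  [::
     (18, 28, 31, 3208); (268, 268, 460, 5450); (55, 55, 247, 1744);
     (72, 72, 79, 1962); (264, 450, 459, 218); (9, 9, 61, 17440);
     (157, 285, 477, 4294); (139, 299, 491, 5450); (8, 8, 60, 2336);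
     (1, 1, 53, 7521); (8, 8, 232, 7256); (84, 89, 95, 6976);
     (281, 281, 473, 3564); (143, 271, 463, 11445); (137, 265, 457, 6213);
     (495, 495, 511, 3815); (67, 80, 119, 5404); (216, 216, 223, 818);
     (274, 280, 287, 1612); (237, 237, 493, 1744); (20, 200, 255, 646);
     (210, 220, 223, 2562); (100, 105, 111, 2398); (264, 402, 511, 1090);
     (60, 60, 252, 2336); (67, 112, 119, 3316); (29, 29, 477, 7838);
     (17, 17, 241, 6976); (21, 21, 469, 3660); (276, 281, 287, 4294);
     (73, 73, 125, 21037); (31, 192, 255, 1464); (25, 201, 509, 3336);
     (65, 65, 117, 17331); (88, 88, 95, 1374); (281, 452, 511, 1744);
     (20, 192, 500, 2132); (25, 41, 253, 8568); (258, 264, 267, 2725);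
     (463, 463, 495, 9919); (76, 98, 127, 9374); (45, 333, 493, 3270);
     (11, 11, 235, 5232); (329, 329, 381, 17331); (324, 345, 383, 3204);
     (284, 284, 476, 2114); (45, 77, 493, 1090); (16, 35, 247, 1852);
     (210, 216, 219, 2670); (172, 268, 492, 1526); (42, 44, 47, 654);
     (72, 72, 124, 13843); (185, 281, 505, 5080); (33, 69, 245, 4687);
     (12, 12, 236, 8720); (226, 236, 239, 5232); (13, 13, 237, 10464);
     (82, 92, 95, 2114); (40, 76, 252, 2616); (4, 25, 63, 3038);
     (34, 40, 43, 1962); (281, 281, 505, 10); (267, 267, 271, 3379);
     (23, 192, 247, 1636); (292, 297, 303, 2834); (15, 15, 239, 2554);
     (35, 272, 503, 1636); (269, 269, 493, 5450); (335, 335, 383, 4469);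
     (232, 232, 488, 8066); (290, 300, 303, 872); (248, 248, 504, 3478);
     (7, 7, 231, 4360); (0, 0, 7, 7848); (27, 200, 255, 818);
     (194, 204, 207, 1744); (57, 89, 249, 10464); (120, 120, 123, 4350);
     (104, 104, 107, 3488); (103, 103, 111, 3488); (19, 19, 243, 5232);
     (20, 20, 468, 1744); (203, 203, 207, 3488); (51, 83, 243, 108);
     (155, 287, 479, 5896); (8, 37, 255, 3706); (11, 11, 15, 1744);
     (16, 16, 23, 1636); (331, 331, 383, 9919); (28, 200, 252, 2024);
     (68, 89, 127, 2180); (61, 61, 253, 10464); (68, 72, 127, 2398);
     (24, 24, 248, 5222); (156, 284, 476, 1374); (3, 3, 227, 3488);
     (106, 108, 111, 1090); (65, 68, 127, 109); (141, 301, 493, 5886);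
     (4, 217, 255, 5682); (7, 7, 55, 6976); (283, 283, 507, 4492);
     (27, 27, 251, 4414); (212, 217, 223, 324); (265, 265, 317, 10464);
     (267, 267, 319, 4578); (16, 195, 247, 872); (18, 24, 251, 990);
     (53, 53, 245, 4033); (9, 9, 233, 3488); (333, 361, 381, 109);
     (82, 88, 91, 8350); (36, 132, 484, 872); (264, 264, 316, 872);
     (1, 1, 449, 11663); (15, 15, 63, 934); (75, 75, 79, 12971);
     (29, 201, 253, 1896); (269, 269, 461, 1526); (169, 265, 509, 3488);
     (56, 144, 251, 862); (280, 280, 283, 2748); (57, 89, 505, 1592);
     (345, 348, 351, 1374); (16, 16, 27, 1744); (52, 52, 63, 872);
     (118, 124, 127, 6867); (51, 83, 499, 3552); (260, 297, 319, 4142);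
     (166, 264, 511, 1199); (73, 256, 459, 654); (43, 43, 47, 1962);
     (88, 272, 475, 2616); (232, 232, 239, 934); (200, 200, 203, 3488);
     (1, 1, 225, 5232); (104, 104, 111, 6976); (48, 91, 251, 2454);
     (5, 5, 229, 13952); (4, 201, 239, 1744); (56, 347, 507, 76);
     (36, 132, 228, 1744)]%num.

Definition pair_tail : config := Config
  [:: (0, 1, 2); (0, 1, 3); (2, 4, 5); (5, 6, 7); (7, 8, 9)]
  [:: 6; 6; 8; 4; 5; 7; 4; 5; 2; 2]%num
  [::
     [:: 0; 1; 2; 3; 4; 5; 6; 7; 8; 9]; [:: 0; 1; 2; 3; 4; 5; 6; 7; 9; 8];
     [:: 1; 0; 2; 3; 4; 5; 6; 7; 8; 9]; [:: 1; 0; 2; 3; 4; 5; 6; 7; 9; 8]]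
  1671896%num
  [::
     (212, 340, 980, 30094128); (13, 13, 237, 60900419);
     (836, 836, 964, 1594076); (800, 800, 811, 6198740);
     (64, 144, 1015, 11208214); (768, 768, 820, 36612088);
     (1, 1, 53, 22578916); (121, 825, 1017, 19197331);
     (199, 199, 207, 300565); (210, 220, 223, 12745037);
     (870, 872, 879, 18390856); (35, 131, 227, 1487048);
     (321, 405, 501, 9324476); (279, 448, 511, 46547434);
     (25, 201, 1021, 26432225); (327, 327, 375, 80869684);
     (960, 960, 967, 28422232); (99, 771, 995, 5015688);
     (257, 257, 481, 12716036); (68, 68, 964, 19193653);
     (256, 256, 267, 20062752); (818, 824, 827, 7845803);
     (450, 456, 459, 23759566); (837, 865, 885, 18526896);
     (352, 352, 359, 26750336); (388, 409, 447, 31545451);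
     (37, 773, 997, 717554); (156, 284, 924, 8745545);
     (911, 911, 959, 17756744); (832, 832, 839, 11703272);
     (243, 243, 1011, 3158944); (135, 295, 999, 31393324);
     (277, 449, 501, 69762409); (850, 860, 863, 22509627);
     (73, 777, 1001, 25016440); (921, 921, 1017, 14240589);
     (464, 464, 475, 30675746); (144, 163, 183, 4830840);
     (9, 9, 233, 10031376); (21, 193, 245, 26724156);
     (769, 769, 821, 8910324); (35, 35, 931, 14986256);
     (908, 908, 1004, 3408478); (395, 395, 447, 10031376);
     (176, 176, 187, 11703272); (32, 848, 1015, 11285881);
     (160, 160, 167, 18390856); (301, 301, 493, 6667523);
     (112, 112, 123, 8091459); (450, 460, 463, 4034403);
     (389, 417, 437, 60188256); (400, 400, 407, 50156880);
     (800, 800, 807, 21734648); (15, 15, 911, 46178976);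
     (416, 416, 423, 33437920); (281, 361, 509, 2395550);
     (928, 928, 935, 24676770); (241, 241, 1009, 38112624);
     (386, 388, 439, 26146285); (133, 293, 997, 60472741);
     (32, 144, 247, 296428); (776, 776, 1000, 192835); (57, 57, 249, 6369473);
     (149, 277, 917, 13666899); (259, 259, 483, 23406544);
     (203, 203, 207, 16736506); (29, 29, 925, 10031376);
     (288, 288, 299, 6687584); (4, 200, 255, 27068447);
     (370, 376, 379, 16718960); (396, 408, 444, 5622326);
     (162, 172, 175, 23393179); (280, 460, 508, 5996973);
     (308, 308, 311, 30094128); (454, 456, 463, 19372141);
     (488, 488, 508, 27136401); (305, 337, 497, 4674704);
     (69, 805, 997, 31472142); (132, 169, 191, 2034888);
     (392, 392, 444, 82658596); (11, 11, 63, 26750336);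
     (387, 400, 439, 21623068); (777, 777, 905, 25023851);
     (67, 803, 995, 3343792); (784, 931, 1015, 13314360);
     (16, 16, 27, 3343792); (880, 880, 891, 31520368);
     (816, 816, 827, 17232637); (295, 295, 303, 18004791);
     (16, 195, 247, 11703272); (146, 152, 155, 26638756);
     (103, 103, 111, 14631784); (864, 864, 871, 35109816);
     (260, 260, 484, 3554432); (73, 73, 125, 69541306);
     (49, 65, 1013, 3516485); (36, 161, 943, 12741056);
     (136, 136, 188, 6314884); (65, 65, 117, 36781712);
     (52, 52, 948, 4027093); (51, 51, 947, 11764080);
     (784, 784, 791, 15047064); (304, 323, 503, 26750336);
     (214, 216, 223, 21734648); (856, 856, 984, 896917);
     (235, 235, 239, 41479289); (770, 776, 779, 52196795);
     (17, 161, 245, 647477); (918, 920, 927, 10031376);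
     (107, 779, 1003, 16303680); (297, 297, 317, 73563424);
     (354, 356, 359, 30094128); (50, 952, 955, 17877179);
     (487, 487, 503, 31705216); (848, 848, 859, 778618);
     (775, 775, 783, 1671896); (278, 280, 287, 19733186);
     (280, 305, 507, 12044256); (466, 476, 479, 58855859);
     (327, 327, 335, 22787868); (20, 20, 916, 5033234);
     (784, 803, 1015, 1671896); (80, 800, 1012, 17207804);
     (244, 244, 255, 29457906); (851, 851, 979, 3477868);
     (275, 275, 499, 70219632); (304, 387, 503, 15158644);
     (7, 7, 231, 38453608); (12, 40, 252, 2258929); (789, 789, 917, 13986077);
     (281, 281, 505, 100908980); (272, 272, 496, 64862960);
     (65, 789, 1013, 2446875); (132, 145, 191, 3386926);
     (80, 80, 976, 171735); (144, 144, 151, 32149502);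
     (130, 132, 135, 33031794); (40, 40, 936, 27449134);
     (863, 863, 991, 4893750); (978, 988, 991, 5238953);
     (866, 876, 879, 16189918); (309, 309, 501, 57963506);
     (354, 364, 367, 52810061); (331, 331, 335, 16718960);
     (998, 1000, 1023, 48502530); (323, 336, 383, 3343792);
     (37, 69, 229, 9225857); (146, 152, 159, 3455372);
     (914, 924, 927, 30094128); (840, 869, 895, 1514054);
     (347, 347, 351, 10031376); (337, 401, 497, 3277165);
     (904, 904, 1000, 38453608); (41, 793, 1021, 27752377);
     (56, 817, 955, 8873157); (16, 227, 247, 31581176);
     (900, 936, 959, 42496198); (13, 153, 253, 10404076);
     (391, 391, 399, 34394185); (820, 820, 948, 11019971);
     (336, 388, 511, 5840312); (97, 769, 993, 11310270);
     (470, 472, 479, 5523461); (852, 856, 863, 24181523);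
     (400, 400, 411, 11814852); (386, 420, 447, 16718960);
     (64, 64, 75, 20006734); (792, 792, 920, 2084413);
     (16, 196, 255, 7005695); (438, 444, 447, 57800729);
     (495, 495, 511, 30461429); (140, 168, 188, 21721283);
     (82, 92, 95, 24960401); (448, 448, 455, 43734950);
     (41, 77, 1021, 4133366); (24, 24, 248, 745702);
     (824, 824, 952, 19549075); (27, 27, 31, 15047064);
     (468, 473, 479, 39278232); (847, 847, 895, 10303456);
     (45, 45, 941, 14674364); (18, 916, 919, 29787635);
     (41, 41, 937, 10031376); (192, 192, 203, 18408402);
     (88, 88, 984, 29920508); (264, 264, 488, 10417441);
     (274, 276, 279, 56349406); (33, 773, 1013, 13072418);
     (912, 912, 919, 6994077); (128, 128, 180, 1671896);
     (285, 457, 509, 13045602); (332, 353, 383, 3343792);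
     (53, 53, 245, 12547540); (864, 864, 875, 5430968);
     (793, 793, 921, 10896797); (466, 472, 475, 19481134);
     (771, 784, 831, 2073993); (928, 928, 939, 21147615);
     (1, 1, 897, 6748460); (79, 79, 127, 33097863); (281, 457, 509, 20745340);
     (24, 204, 1020, 38771719); (455, 455, 463, 265654);
     (845, 857, 893, 15183104); (108, 780, 1004, 5015688);
     (487, 487, 495, 11764080); (93, 93, 989, 36783392);
     (840, 840, 892, 25078440); (944, 944, 955, 11703272);
     (296, 396, 508, 10031376); (384, 384, 391, 100313760);
     (232, 232, 252, 12180052); (256, 256, 308, 13375168);
     (208, 208, 215, 27927174); (776, 776, 828, 2782938);
     (105, 777, 1001, 2230544); (832, 832, 884, 50156880);
     (32, 32, 928, 25696947); (56, 88, 248, 5941882); (9, 9, 61, 118331916);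
     (288, 401, 503, 16718960); (217, 345, 985, 19114510);
     (83, 83, 979, 8225404); (232, 232, 1000, 4857019); (9, 9, 905, 35164405);
     (352, 352, 363, 30094128); (25, 25, 249, 32084135);
     (2, 8, 235, 66557729); (273, 273, 497, 52236387);
     (40, 268, 956, 15433129); (271, 271, 495, 64012019); (0, 0, 7, 65840166);
     (242, 248, 251, 5015688); (257, 257, 309, 104776594);
     (391, 391, 439, 49200615); (188, 316, 956, 12989103);
     (304, 304, 315, 14935484); (176, 272, 1008, 1783476);
     (402, 404, 415, 37276770); (290, 292, 295, 43350370);
     (34, 940, 943, 39087720); (131, 176, 191, 11888120);
     (43, 43, 939, 3930825); (65, 149, 1013, 7615825); (3, 3, 227, 41797400);
     (284, 456, 508, 20400341); (105, 781, 1021, 12328156);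
     (772, 808, 831, 29605284); (995, 1008, 1015, 111580);
     (783, 783, 831, 2296780); (258, 268, 495, 12915258);
     (317, 317, 509, 63532048); (272, 272, 279, 6916988);
     (780, 780, 1004, 2158054); (7, 7, 15, 17355182);
     (228, 228, 996, 1671896); (15, 15, 63, 683301);
     (976, 976, 987, 31766024); (805, 805, 933, 6845426);
     (194, 196, 199, 18072745); (0, 0, 224, 16082738);
     (993, 993, 1013, 16506315); (163, 291, 931, 10031376);
     (786, 796, 799, 16718960); (77, 89, 125, 604286);
     (313, 313, 505, 12779948); (868, 873, 879, 8421480);
     (425, 425, 445, 5951892); (280, 396, 508, 12052899);
     (929, 929, 993, 2942122); (24, 140, 252, 386065);
     (81, 129, 245, 10810202); (136, 296, 1000, 45513892);
     (825, 825, 953, 15242630); (33, 81, 1013, 753501);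
     (416, 416, 427, 36781712); (992, 992, 999, 23821824);
     (220, 348, 988, 21010994); (20, 192, 1023, 33420374);
     (459, 459, 463, 7040606); (361, 361, 381, 12426926);
     (76, 812, 1004, 14496220); (179, 307, 947, 3343792);
     (299, 347, 511, 3343792); (129, 129, 181, 43469296);
     (49, 49, 945, 16718960); (165, 293, 933, 2696315);
     (76, 88, 124, 1331839); (392, 421, 447, 7623788);
     (409, 425, 445, 735692); (283, 283, 507, 10031376);
     (280, 280, 504, 16718960); (496, 496, 507, 74894336);
     (116, 116, 119, 1671896); (146, 148, 151, 14552006);
     (34, 44, 47, 20649785); (292, 324, 484, 6476944); (60, 60, 252, 1671896);
     (59, 59, 955, 3343792); (111, 779, 1007, 5482730);
     (11, 11, 907, 1671896); (198, 200, 207, 11385161);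
     (57, 57, 953, 10349487); (897, 897, 949, 70219632);
     (88, 824, 1016, 1259379); (143, 143, 191, 23188270);
     (215, 343, 983, 4191064); (148, 276, 916, 7182642);
     (12, 12, 236, 11703272); (320, 320, 327, 113688928);
     (772, 772, 996, 4743048); (225, 225, 245, 16718960);
     (802, 808, 811, 2160740); (130, 140, 191, 2971092);
     (770, 780, 783, 12328156); (897, 897, 993, 12285299);
     (899, 912, 1015, 5015688); (423, 423, 431, 1299196);
     (288, 403, 503, 9980604); (125, 829, 1021, 6613544);
     (788, 788, 916, 9212279); (16, 16, 912, 5150446);
     (173, 301, 941, 3706784); (28, 28, 924, 25078440);
     (432, 432, 443, 38565188); (912, 960, 1012, 9859641);
     (769, 769, 897, 12224423); (75, 779, 1003, 35053798);
     (912, 912, 923, 18390856); (37, 37, 933, 13463133);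
     (137, 137, 189, 50892572); (464, 464, 471, 26168718);
     (920, 920, 1016, 13787685); (322, 332, 383, 3673358);
     (97, 785, 1013, 12962651); (81, 81, 977, 22715910);
     (64, 768, 1015, 6687584); (850, 852, 855, 3387910);
     (6, 1000, 1007, 41779854); (16, 16, 23, 1671896);
     (781, 781, 909, 16718960); (332, 352, 383, 20062752);
     (32, 152, 255, 5015688); (151, 151, 159, 28310652);
     (64, 788, 1015, 15866161); (61, 61, 253, 81550204);
     (489, 489, 509, 46333117); (971, 971, 975, 6581283);
     (258, 316, 319, 90282384); (259, 272, 311, 33437920);
     (292, 328, 495, 329566); (123, 795, 1019, 4001965);
     (49, 337, 1009, 5356672); (264, 264, 316, 113302863);
     (224, 224, 244, 44504970); (333, 409, 509, 10360942);
     (96, 96, 103, 36366432); (210, 212, 215, 8029914); (43, 43, 47, 1084863);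
     (261, 401, 501, 8646680); (73, 809, 1001, 9534728);
     (338, 348, 351, 60188256); (64, 64, 71, 14779043);
     (406, 408, 415, 39630446); (434, 440, 443, 10031376);
     (51, 403, 1011, 14986256); (164, 169, 175, 8359480);
     (835, 880, 887, 13375168); (896, 896, 903, 68302080);
     (208, 208, 219, 18390856); (82, 984, 991, 4292034);
     (36, 840, 1007, 5037490); (397, 409, 445, 2387527);
     (884, 884, 887, 38453608); (77, 77, 973, 11981308);
     (836, 840, 847, 10167416); (289, 321, 481, 35142859);
     (7, 7, 55, 25078440); (263, 263, 487, 133751680);
     (211, 339, 979, 6687584); (2, 12, 15, 27835199);
     (833, 833, 885, 45005152); (284, 328, 508, 7635826);
     (199, 335, 975, 2725116); (260, 265, 271, 74043395);
     (336, 336, 347, 30094128); (133, 325, 997, 9340765);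
     (84, 84, 980, 15871688); (105, 793, 1021, 14653106);
     (768, 768, 896, 16473304); (262, 296, 495, 4972554);
     (336, 336, 343, 40972776); (259, 304, 503, 13375168);
     (66, 72, 79, 44801135); (147, 339, 1011, 6687584);
     (153, 313, 1017, 36781712); (272, 451, 503, 10031376);
     (36, 324, 996, 210640); (917, 961, 1013, 34060247);
     (21, 21, 917, 10057556); (329, 329, 381, 113688928);
     (779, 779, 831, 10403651); (813, 813, 941, 6063180);
     (193, 321, 961, 18735147); (35, 784, 951, 1917552);
     (306, 312, 315, 43469296); (290, 300, 303, 38839673);
     (4, 4, 900, 17417758); (273, 449, 501, 21492529);
     (772, 809, 831, 1047492); (33, 389, 1013, 3343792);
     (836, 849, 895, 10884175); (24, 76, 252, 11925290);
     (52, 52, 63, 11019971); (773, 801, 821, 27871388); (5, 5, 229, 27555855);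
     (843, 843, 895, 36725694); (84, 89, 991, 9206752);
     (908, 928, 959, 8294794); (296, 332, 508, 16389394);
     (999, 999, 1015, 3386372); (964, 969, 975, 31487988);
     (882, 888, 891, 2931275); (56, 784, 1019, 13607193);
     (265, 265, 489, 93146205); (480, 480, 500, 43469296);
     (48, 147, 1019, 1671896); (115, 787, 1011, 8627501);
     (924, 968, 1020, 2618815); (834, 844, 847, 25214480);
     (67, 112, 119, 20330773); (836, 857, 895, 5776565);
     (482, 508, 511, 64277673); (796, 796, 924, 3904646);
     (960, 960, 971, 171735); (1003, 1003, 1007, 12903870);
     (135, 135, 183, 25263288); (166, 168, 175, 6700949);
     (261, 261, 485, 100069694); (899, 899, 995, 6687584);
     (85, 85, 981, 10031376); (256, 256, 263, 117032720);
     (260, 360, 495, 19372141); (835, 835, 963, 1671896);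
     (32, 68, 247, 467042); (932, 932, 996, 1671896); (32, 145, 247, 6040107);
     (197, 325, 965, 16718960); (139, 139, 191, 11703272);
     (80, 80, 91, 19402173); (786, 792, 795, 27448861);
     (41, 89, 1021, 8239761); (114, 120, 123, 20988946);
     (91, 795, 1019, 14268446); (772, 785, 831, 6401576);
     (375, 375, 383, 618676); (358, 360, 367, 30784739);
     (452, 457, 463, 36781712); (65, 773, 1013, 1807936);
     (393, 393, 445, 100313760); (288, 288, 295, 36141873);
     (8, 8, 232, 1990007); (209, 337, 977, 20129379);
     (1000, 1000, 1020, 406866); (91, 91, 95, 3461831);
     (848, 848, 855, 25034322); (422, 424, 431, 88983188);
     (100, 105, 111, 18857898); (320, 320, 372, 10031376);
     (178, 184, 187, 16718960); (69, 145, 245, 2771297);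
     (96, 768, 992, 8774760); (4, 97, 247, 336876); (141, 153, 189, 13002468);
     (169, 169, 189, 6324592); (962, 968, 971, 21456612);
     (274, 280, 287, 23736110); (802, 812, 815, 20124752);
     (982, 984, 991, 34884871); (268, 472, 508, 5089533);
     (919, 919, 927, 5015688); (820, 820, 823, 27264013);
     (368, 368, 379, 43469296); (71, 71, 119, 16450939);
     (268, 268, 492, 36781712); (98, 104, 107, 24663160);
     (841, 841, 893, 68485736); (964, 968, 975, 1003013);
     (978, 980, 983, 40950128); (338, 340, 343, 6687584);
     (780, 792, 828, 8920334); (269, 269, 493, 147146909);
     (48, 48, 59, 15047064); (76, 76, 972, 668883); (25, 205, 253, 5015688);
     (102, 104, 111, 7102864); (128, 128, 135, 63532048);
     (402, 408, 411, 11591692); (903, 903, 951, 53255016);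
     (328, 412, 508, 29764562); (32, 32, 39, 8359480);
     (32, 848, 1012, 1354787); (45, 45, 237, 2631629);
     (385, 385, 437, 101874076); (72, 72, 124, 10371433);
     (328, 328, 380, 36781712); (336, 355, 375, 10031376);
     (321, 321, 373, 100313760); (784, 784, 795, 4196718);
     (83, 819, 1011, 3075771); (83, 787, 1011, 5149764);
     (389, 401, 437, 9427325); (291, 323, 483, 13375168);
     (19, 48, 251, 25078440); (777, 777, 829, 70145592);
     (5, 97, 1013, 883923); (137, 313, 1021, 12639476);
     (155, 315, 1019, 21623068); (4, 201, 239, 10349487);
     (212, 217, 223, 10661507); (240, 240, 251, 11703272);
     (162, 164, 167, 6687584); (131, 160, 183, 11703272);
     (68, 89, 127, 18730913); (804, 809, 815, 14985064);
     (293, 293, 485, 244066); (80, 80, 87, 15047064);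
     (289, 289, 481, 9731194); (68, 804, 996, 3405792);
     (384, 384, 436, 16718960); (160, 160, 171, 11703272);
     (135, 135, 143, 38235334); (901, 901, 997, 10031376);
     (771, 771, 995, 10142956); (17, 17, 241, 59847272);
     (386, 396, 399, 9075111); (328, 353, 383, 22458302);
     (345, 361, 381, 27698578); (905, 905, 957, 96969968);
     (36, 929, 935, 13776838); (267, 267, 491, 63532048);
     (771, 816, 823, 11189595); (324, 344, 383, 63532048);
     (288, 325, 495, 34128531); (16, 67, 247, 4747667);
     (795, 795, 799, 11703272); (73, 793, 1021, 10928293)]%num.

(** * Verification of the certificates by computation *)

Lemma star4_verified : verify star4.
Proof. by vm_compute. Qed.

Lemma star5_common_pair_verified : verify star5_common_pair.
Proof. by vm_compute. Qed.

Lemma star5_verified : verify star5.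
Proof. by vm_compute. Qed.

Lemma star6_verified : verify star6.
Proof. by vm_compute. Qed.

Lemma star7_verified : verify star7.
Proof. by vm_compute. Qed.

Lemma loose_triangle_verified : verify loose_triangle.
Proof. by vm_compute. Qed.

Lemma pair_bridge_verified : verify pair_bridge.
Proof. by vm_compute. Qed.

Lemma pair_pair_verified : verify pair_pair.
Proof. by vm_compute. Qed.

Lemma pair_wedge_verified : verify pair_wedge.
Proof. by vm_compute. Qed.

Lemma pair_two_pendants_verified : verify pair_two_pendants.
Proof. by vm_compute. Qed.

Lemma spider_verified : verify spider.
Proof. by vm_compute. Qed.

Lemma dumbbell0_verified : verify dumbbell0.
Proof. by vm_compute. Qed.

Lemma dumbbell1_verified : verify dumbbell1.
Proof. by vm_compute. Qed.

Lemma pair_tail_verified : verify pair_tail.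
Proof. by vm_compute. Qed.

(** * Families of triples *)

Definition triple (a b c : nat) : {fset nat} := [fset a; b; c]%fset.

(** Other members of A may meet [v] in any way, so avoiding a configuration passes to
    subfamilies. *)
Definition embeds (A : fam) (c : config) (v : seq nat) : bool :=
  [&& uniq v, size v == nverts c &
      all (fun e => triple (nth 0 v e.1.1) (nth 0 v e.1.2) (nth 0 v e.2) \in A) (triples c)].

Lemma dot_trace ws v X : size v = size ws ->
  dot ws (trace v X) = \sum_(i < size ws) nth 0 ws i * (nth 0 v i \in X).
Proof.
elim: ws v => [|w ws IH] [|a v] //= => [_|[hs]]; first by rewrite big_ord0.
rewrite big_ord_recl /= -IH // /dot /=.
by case: (a \in X); rewrite /= ?muln1 ?muln0.
Qed.

(** An averaging argument: if every vertex of [v] lay in fewer than half of the members of F, the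
    weighted sum of 2 w(X) over F would be smaller than that of w(S), against the inequality summed
    over all fibres. *)
Lemma FC_embeds c (A : fam) v : verify c -> embeds A c v -> FC (gen A).
Proof.
move=> ok /and3P[uv /eqP size_v edgesA] F ucF AF.
case/and5P: (ok) => _ triples_lt cover _ /andP[W_gt0 _].
have edgeA e : e \in triples c -> realize v (edge_bits (nverts c) e) \in A.
  move=> he; have := allP edgesA _ he; rewrite -size_v realize_edge //.
  by rewrite size_v; apply: (allP triples_lt).
have [/hasP[y yv le_y]|no_y] :=
    boolP (has (fun y => #|` F| <= 2 * #|` [fset X in F | y \in X]|) v)%fset.
  exists y => //; apply/UfamP.
  (* The abundant vertex must lie in the union of the generated family; the covering test of
     [verify] supplies a triple through it. *)
  have iv : index y v \in iota 0 (nverts c) by rewrite mem_iota -size_v index_mem.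
  have /hasP[e he i_e] := allP cover _ iv.
  exists (realize v (edge_bits (nverts c) e)); first exact/gen_sub/edgeA.
  have := allP triples_lt _ he; rewrite -size_v => /realize_edge ->.
  by move: i_e; rewrite !inE -orbA => /or3P[]/eqP <-; rewrite nth_index // eqxx ?orbT.
exfalso; set ws := map N.to_nat (weights c).
have size_ws : size v = size ws by rewrite size_v size_map.
have ineq : \sum_(X <- F) sumn ws <= \sum_(X <- F) 2 * dot ws (trace v X).
  rewrite (fiber_sum (fun=> sumn ws) _ uv) (fiber_sum (fun s => 2 * dot ws s) _ uv).
  apply: leq_sum => Y _; rewrite size_v.
  (* The fibre over Y is union-closed because F is, and stable under adding the triples because
     these belong to F. *)
  apply: (verify_weigh (x := fun s => (Y `|` realize v s)%fset \in F)) => // [e s he hs|s t hs ht].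
    rewrite realize_bunion ?size_v ?size_edge_bits // fsetUA => hY.
    by apply: ucF => //; apply: (fsubsetP AF); apply/gen_sub/edgeA.
  rewrite realize_bunion ?size_v // => hY hY'.
  by have := ucF _ _ hY hY'; rewrite fsetUACA fsetUid.
suff: \sum_(X <- F) 2 * dot ws (trace v X) < \sum_(X <- F) sumn ws by rewrite ltnNge ineq.
under eq_bigr do rewrite dot_trace // big_distrr /=.
rewrite exchange_big /=.
have degE y : \sum_(X <- F) (y \in X) = #|` [fset X in F | y \in X]%fset|.
  by rewrite card_fset_sum1 big_fset /= [RHS]big_mkcond /=; apply: eq_bigr => X _; case: (y \in X).
have lt_deg (i : 'I_(size ws)) : 2 * \sum_(X <- F) (nth 0 v i \in X) < #|` F|.
  by rewrite ltnNge degE; apply: (hasPn no_y); rewrite mem_nth // size_ws.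
have W_pos : 0 < sumn ws.
  have -> : sumn ws = N.to_nat (weight_sum (weights c)).
    by rewrite /ws; elim: (weights c) => //= w u ->; rewrite Nnat.N2Nat.inj_add.
  by move/N.ltb_lt: W_gt0; lia.
have sum_ws : sumn ws = \sum_(i < size ws) nth 0 ws i.
  by rewrite sumnE (big_nth 0) big_mkord.
have -> : \sum_(X <- F) sumn ws = \sum_(i < size ws) nth 0 ws i * #|` F|.
  by rewrite -big_distrl /= -sum_ws card_fset_sum1 big_distrr /=; under [RHS]eq_bigr do rewrite muln1.
(* Strictness comes from the slack of one in each degree inequality 2 deg + 1 <= |F|: weighted and
   summed over the vertices, it amounts to [sumn ws], which is positive. *)
apply: leq_trans (_ : _ <=
  \sum_(i < size ws) \sum_(X <- F) 2 * (nth 0 ws i * (nth 0 v i \in X)) + sumn ws) _.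
  by rewrite -addn1 leq_add2l.
rewrite sum_ws -big_split /=; apply: leq_sum => i _.
rewrite -big_distrr -big_distrr /= mulnCA -{2}(muln1 (nth 0 ws i)) -mulnDr addn1 leq_mul2l.
by rewrite lt_deg orbT.
Qed.

(** * Triples described by their elements, and tactics for exhibiting configurations *)

Lemma tripleCA a b c : triple a b c = triple b a c.
Proof. by apply/fsetP => y; rewrite !inE (orbC (y == a)). Qed.

Lemma tripleAC a b c : triple a b c = triple a c b.
Proof. by apply/fsetP => y; rewrite !inE orbAC. Qed.

Lemma in_triple y a b c : (y \in triple a b c) = [|| y == a, y == b | y == c].
Proof. by rewrite !inE -orbA. Qed.

Lemma notin_triple y a b c : y \notin triple a b c -> [/\ y != a, y != b & y != c].
Proof. by rewrite in_triple !negb_or => /and3P. Qed.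

Lemma triple_third X a b : #|` X| = 3 -> a \in X -> b \in X -> a != b ->
  exists c, [/\ X = triple a b c, a != c & b != c].
Proof.
move=> X3 aX bX ab.
have bXa : b \in (X `\ a)%fset by rewrite !inE eq_sym ab.
have : #|` (X `\ a) `\ b|%fset == 1.
  by apply/eqP; move: X3; rewrite (cardfsD1 a) aX (cardfsD1 b (X `\ a)%fset) bXa; lia.
case/cardfs1P => c defc.
have := fset11 c; rewrite -defc !inE => /and3P[cb ca cX].
exists c; rewrite eq_sym ca eq_sym cb; split => //; apply/fsetP => y; rewrite in_triple.
have := congr1 (fun Z : {fset nat} => y \in Z) defc; rewrite /= !inE.
case: (y =P a) => [->|_] /=; first by rewrite aX.
by case: (y =P b) => [->|_] /=; first by rewrite bX.
Qed.

Lemma triple_others X a : #|` X| = 3 -> a \in X ->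
  exists b c, [/\ X = triple a b c, a != b, a != c & b != c].
Proof.
move=> X3 aX.
have /fset0Pn[b] : (X `\ a)%fset != fset0.
  by rewrite -cardfs_gt0; move: X3; rewrite (cardfsD1 a) aX; lia.
rewrite !inE eq_sym => /andP[ab bX].
by have [c [-> ac bc]] := triple_third X3 aX bX ab; exists b, c.
Qed.

Ltac split_notin :=
  repeat match goal with
  | H : is_true (_ \notin triple _ _ _) |- _ => destruct (notin_triple H) as [? ? ?]; clear H
  end.

Ltac triple_mem :=
  first [ assumption
        | rewrite tripleCA; assumption
        | rewrite tripleAC; assumption
        | rewrite tripleCA tripleAC; assumption
        | rewrite tripleAC tripleCA; assumption
        | rewrite tripleCA tripleAC tripleCA; assumption ].

Ltac split_uniq := rewrite /= !inE !negb_or -!andbA; repeat (case/andP; intro).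

Ltac neq := solve [assumption | rewrite eq_sym; assumption].

Ltac mem_triple := solve [assumption | rewrite in_triple ?eqxx ?orbT //].

(** Refutes the current case by the explicit placement [v] of a configuration. Non-memberships are
    first split into inequalities, and triples are matched in any order of their elements. *)
Ltac found avoid c_ok v :=
  exfalso; split_notin; move/negP: (avoid _ v c_ok); apply;
  rewrite /embeds /= !inE !negb_or -!andbA;
  repeat (apply/andP; split); solve [done | neq | triple_mem].

(** * Local structure of a family that avoids the configurations *)

Section NoConfiguration.
Variable A : fam.
Hypothesis A3 : forall X, X \in A -> #|` X| = 3.
Hypothesis avoid : forall c v, verify c -> ~~ embeds A c v.

(** In the link of a, X and Y are two edges meeting in b, hence a path from c over b to d. The cases
    place the edge of Z: at b, at c (closing a triangle if it ends in d), at d, or off the path.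
    Each gives a star. *)
Lemma no_star_pair X Y Z a b : X \in A -> Y \in A -> Z \in A ->
  X != Y -> X != Z -> Y != Z -> a != b ->
  a \in X -> a \in Y -> a \in Z -> b \in X -> b \in Y -> False.
Proof.
move=> XA YA ZA XY XZ YZ ab aX aY aZ bX bY.
have [c [defX ac bc]] := triple_third (A3 XA) aX bX ab.
have [d [defY ad bd]] := triple_third (A3 YA) aY bY ab; subst.
have cd : c != d by apply: contraNneq XY => ->.
have [bZ|bZ] := boolP (b \in Z).
  have [k [defZ ak bk]] := triple_third (A3 ZA) aZ bZ ab; subst.
  have ck : c != k by apply: contraNneq XZ => ->.
  have dk : d != k by apply: contraNneq YZ => ->.
  found avoid star5_common_pair_verified [:: a; b; c; d; k].
have [cZ|cZ] := boolP (c \in Z).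
  have [k [defZ ak ck]] := triple_third (A3 ZA) aZ cZ ac; subst.
  have [eq_dk|dk] := eqVneq d k.
    subst; found avoid star4_verified [:: a; b; c; k].
  found avoid star5_verified [:: a; b; c; d; k].
have [dZ|dZ] := boolP (d \in Z).
  have [k [defZ ak dk]] := triple_third (A3 ZA) aZ dZ ad; subst.
  found avoid star5_verified [:: a; b; d; c; k].
have [k [l [defZ ak al kl]]] := triple_others (A3 ZA) aZ; subst.
found avoid star6_verified [:: a; b; c; d; k; l].
Qed.

(** By [no_star_pair] any two of the three members meet in a only, which leaves [star7]. *)
Lemma degree_le2 X Y Z a : X \in A -> Y \in A -> Z \in A ->
  X != Y -> X != Z -> Y != Z -> a \in X -> a \in Y -> a \in Z -> False.
Proof.
move=> XA YA ZA XY XZ YZ aX aY aZ.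
have [YX ZX ZY] : [/\ Y != X, Z != X & Z != Y] by split; rewrite eq_sym.
have [b [c [defX ab ac bc]]] := triple_others (A3 XA) aX.
have [d [p [defY ad ap dp]]] := triple_others (A3 YA) aY.
have [q [r [defZ aq ar qr]]] := triple_others (A3 ZA) aZ.
have sepXY y : y \in X -> a != y -> y \notin Y.
  by move=> yX ay; apply/negP => yY; apply: (@no_star_pair X Y Z a y).
have sepXZ y : y \in X -> a != y -> y \notin Z.
  by move=> yX ay; apply/negP => yZ; apply: (@no_star_pair X Z Y a y).
have sepYZ y : y \in Y -> a != y -> y \notin Z.
  by move=> yY ay; apply/negP => yZ; apply: (@no_star_pair Y Z X a y).
have bY : b \notin Y by apply: sepXY; rewrite // defX; mem_triple.
have cY : c \notin Y by apply: sepXY; rewrite // defX; mem_triple.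
have bZ : b \notin Z by apply: sepXZ; rewrite // defX; mem_triple.
have cZ : c \notin Z by apply: sepXZ; rewrite // defX; mem_triple.
have dZ : d \notin Z by apply: sepYZ; rewrite // defY; mem_triple.
have pZ : p \notin Z by apply: sepYZ; rewrite // defY; mem_triple.
subst; found avoid star7_verified [:: a; b; c; d; p; q; r].
Qed.

Lemma notin_third X Y Z a : X \in A -> Y \in A -> Z \in A ->
  X != Y -> a \in X -> a \in Y -> X != Z -> Y != Z -> a \notin Z.
Proof. by move=> XA YA ZA XY aX aY XZ YZ; apply/negP; apply: (@degree_le2 X Y Z). Qed.

Lemma mem_neq (X Y : {fset nat}) a : a \in X -> a \notin Y -> X != Y.
Proof. by move=> aX; apply: contraNneq => <-. Qed.

(** The degree bound keeps a and b out of Z, so its third vertex is new and [pair_bridge]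
    appears. *)
Lemma no_pair_bridge a b c d Z : triple a b c \in A -> triple a b d \in A ->
  a != b -> a != c -> b != c -> a != d -> b != d -> c != d ->
  Z \in A -> c \in Z -> d \in Z -> False.
Proof.
move=> XA YA ab ac bc ad bd cd ZA cZ dZ.
have dX : d \notin triple a b c by rewrite in_triple !negb_or !(eq_sym d) ad bd cd.
have cY : c \notin triple a b d by rewrite in_triple !negb_or !(eq_sym c) ac bc eq_sym cd.
have XY : triple a b c != triple a b d by apply: (mem_neq (a := c)); rewrite // in_triple eqxx !orbT.
have XZ : triple a b c != Z by rewrite eq_sym; apply: (mem_neq dZ).
have YZ : triple a b d != Z by rewrite eq_sym; apply: (mem_neq cZ).
have aZ : a \notin Z by apply: (notin_third XA YA); rewrite // in_triple eqxx.
have bZ : b \notin Z by apply: (notin_third XA YA); rewrite // in_triple eqxx orbT.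
have [k [defZ ck dk]] := triple_third (A3 ZA) cZ dZ cd; subst.
found avoid pair_bridge_verified [:: a; b; c; d; k].
Qed.

(** If Y and Z meet in y only, the three members form a loose triangle with corners a, b, y. If they
    share a second vertex, they are a couple whose free vertices a and b are bridged by the given
    triple. *)
Lemma no_triangle a b c Y Z y : triple a b c \in A -> Y \in A -> Z \in A ->
  a != b -> a != c -> b != c -> a \in Y -> b \notin Y -> c \notin Y ->
  b \in Z -> a \notin Z -> c \notin Z -> y \in Y -> y \in Z -> False.
Proof.
move=> XA YA ZA ab ac bc aY bY cY bZ aZ cZ yY yZ.
have ay : a != y by apply: contraNneq aZ => ->.
have by_ : b != y by apply: contraNneq bY => ->.
have [p [defY ap yp]] := triple_third (A3 YA) aY yY ay.
have [q [defZ bq yq]] := triple_third (A3 ZA) bZ yZ by_; subst.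
have [eq_pq|pq] := eqVneq p q.
  subst; split_notin; apply: (@no_pair_bridge y q a b (triple a b c));
    rewrite ?in_triple ?eqxx ?orbT //; try neq; triple_mem.
found avoid loose_triangle_verified [:: a; c; b; q; y; p].
Qed.

(** By [no_triangle] the members hanging at a, b and c are pairwise disjoint, so together with the
    central triple they form [spider]. *)
Lemma no_center a b c X Y Z : triple a b c \in A -> X \in A -> Y \in A -> Z \in A ->
  a != b -> a != c -> b != c -> a \in X -> b \notin X -> c \notin X ->
  b \in Y -> a \notin Y -> c \notin Y -> c \in Z -> a \notin Z -> b \notin Z -> False.
Proof.
move=> eA XA YA ZA ab ac bc aX bX cX bY aY cY cZ aZ bZ.
have [p [q [defX ap aq pq]]] := triple_others (A3 XA) aX.
have [r [s [defY br bs rs]]] := triple_others (A3 YA) bY.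
have [t [u [defZ ct cu tu]]] := triple_others (A3 ZA) cZ.
have sepXY y : y \in X -> y \notin Y.
  by move=> yX; apply/negP => yY; apply: (@no_triangle a b c X Y y).
have sepXZ y : y \in X -> y \notin Z.
  move=> yX; apply/negP => yZ; apply: (@no_triangle a c b X Z y) => //; first by rewrite tripleAC.
  by rewrite eq_sym.
have sepYZ y : y \in Y -> y \notin Z.
  move=> yY; apply/negP => yZ; apply: (@no_triangle b c a Y Z y) => //; try by rewrite eq_sym.
  by rewrite tripleAC tripleCA.
have [pY qY] : p \notin Y /\ q \notin Y by split; apply: sepXY; rewrite defX; mem_triple.
have [pZ qZ] : p \notin Z /\ q \notin Z by split; apply: sepXZ; rewrite defX; mem_triple.
have [rZ sZ] : r \notin Z /\ s \notin Z by split; apply: sepYZ; rewrite defY; mem_triple.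
subst; found avoid spider_verified [:: a; b; c; p; q; r; s; t; u].
Qed.

(** A member with two private vertices is deleted in the induction of [avoiding_card_le_half]; the
    remaining case is analysed under this assumption. *)
Hypothesis few_private : forall X p q, X \in A -> p \in X -> q \in X -> p != q ->
  exists2 Y, Y \in A & (Y != X) && ((p \in Y) || (q \in Y)).

(** L continues a path of triples that starts at the couple sharing a and b. If L contains u, it
    forms a second couple and [dumbbell1] appears; otherwise its other two vertices are new and
    [pair_tail] appears. *)
Lemma no_long_tail a b c d x y z u L :
  triple a b c \in A -> triple a b d \in A -> triple c x y \in A -> triple x z u \in A ->
  uniq [:: a; b; c; d; x; y; z; u] ->
  a \notin L -> b \notin L -> c \notin L -> d \notin L -> x \notin L -> y \notin L ->
  L \in A -> z \in L -> False.
Proof.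
move=> eA fA hA kA; split_uniq => _ aL bL cL dL xL yL LA zL.
have [uL|uL] := boolP (u \in L).
  have [w [defL zw uw]] : exists w, [/\ L = triple z u w, z != w & u != w].
    by apply: triple_third => //; apply: A3.
  by subst; found avoid dumbbell1_verified [:: a; b; c; d; y; x; z; u; w].
have [s [t [defL zs zt st]]] := triple_others (A3 LA) zL.
subst; found avoid pair_tail_verified [:: a; b; c; d; y; x; u; z; s; t].
Qed.

(** The path leaving the couple at c is followed one triple further. Either K contains y too, which
    is [dumbbell0], or y lies in another member, which makes the triple on c, x, y a centre, or y is
    private and [few_private] prolongs the path beyond K. *)
Lemma no_tail a b c d x y K :
  triple a b c \in A -> triple a b d \in A -> triple c x y \in A ->
  uniq [:: a; b; c; d; x; y] -> (forall X, X \in A -> d \in X -> X = triple a b d) ->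
  K \in A -> K != triple c x y -> x \in K -> False.
Proof.
move=> eA fA hA uniq6 d_private KA Kh xK.
have := uniq6; split_uniq => _.
pose simp := (in_triple, negb_or, eqxx, orbT, andbT).
have ce : c \in triple a b c by rewrite !simp.
have ch : c \in triple c x y by rewrite !simp.
have ae : a \in triple a b c by rewrite !simp.
have be : b \in triple a b c by rewrite !simp.
have af : a \in triple a b d by rewrite !simp.
have bf : b \in triple a b d by rewrite !simp.
have xh : x \in triple c x y by rewrite !simp.
have cf : c \notin triple a b d by rewrite !simp; apply/and3P; split; neq.
have xe : x \notin triple a b c by rewrite !simp; apply/and3P; split; neq.
have xf : x \notin triple a b d by rewrite !simp; apply/and3P; split; neq.
have ye : y \notin triple a b c by rewrite !simp; apply/and3P; split; neq.
have yf : y \notin triple a b d by rewrite !simp; apply/and3P; split; neq.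
have ah : a \notin triple c x y by rewrite !simp; apply/and3P; split; neq.
have ef := mem_neq ce cf.
have eh := mem_neq ae ah.
have eK : triple a b c != K by rewrite eq_sym (mem_neq xK xe).
have fK : triple a b d != K by rewrite eq_sym (mem_neq xK xf).
have aK : a \notin K by apply: (notin_third eA fA).
have bK : b \notin K by apply: (notin_third eA fA).
have cK : c \notin K by apply: (notin_third eA hA); rewrite // eq_sym.
have dK : d \notin K by apply: contraL fK => /(d_private _ KA) ->; rewrite negbK.
have xy : x != y by neq.
have [yK|yK] := boolP (y \in K).
  have [z [defK xz yz]] := triple_third (A3 KA) xK yK xy; subst.
  found avoid dumbbell0_verified [:: a; b; c; d; x; y; z].
have [/hasP[L LA /andP[Lh yL]]|no_L] := boolP (has (fun L => (L != triple c x y) && (y \in L)) A).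
  have KL : K != L by rewrite eq_sym (mem_neq yL yK).
  have eL : triple a b c != L by rewrite eq_sym (mem_neq yL ye).
  have hL : triple c x y != L by rewrite eq_sym.
  have hK : triple c x y != K by rewrite eq_sym.
  (* The three vertices c, x, y are occupied by the triple on a, b, c, by K and by L
     respectively. *)
  apply: (@no_center c x y (triple a b c) K L) => //; try neq.
  - exact: (notin_third eA hA).
  - exact: (notin_third hA KA).
have y_private M : M \in A -> M != triple c x y -> y \notin M.
  by move=> MA Mh; have := hasPn no_L _ MA; rewrite Mh.
(* Stated for either order of the remaining vertices of K, since [few_private] does not tell which
   of them is shared. The degree bound keeps L away from a, b, c, x, and privacy keeps it away from
   d and y. *)
have long z u L : K = triple x z u -> x != z -> x != u -> z != u ->
    L \in A -> L != K -> z \in L -> False.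
  move=> defK xz xu zu LA LK zL; have zK : z \in K by rewrite defK !simp.
  have ze : z \notin triple a b c.
    by rewrite !simp; apply/and3P; split; apply: contraTneq zK => ->.
  have zf : z \notin triple a b d.
    by rewrite !simp; apply/and3P; split; apply: contraTneq zK => ->.
  have zh : z \notin triple c x y.
    by rewrite !simp; apply/and3P; split;
      [apply: contraTneq zK => -> | neq | apply: contraTneq zK => ->].
  have eL : triple a b c != L by rewrite eq_sym (mem_neq zL ze).
  have fL : triple a b d != L by rewrite eq_sym (mem_neq zL zf).
  have Lh : L != triple c x y by apply: (mem_neq zL zh).
  have hL : triple c x y != L by rewrite eq_sym.
  have hK : triple c x y != K by rewrite eq_sym.
  have KL : K != L by rewrite eq_sym.
  have aL : a \notin L by apply: (notin_third eA fA).
  have bL : b \notin L by apply: (notin_third eA fA).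
  have cL : c \notin L by apply: (notin_third eA hA).
  have xL : x \notin L by apply: (notin_third hA KA).
  have dL : d \notin L by apply: contra fL => /(d_private _ LA) ->.
  have yL := y_private _ LA Lh; subst K.
  apply: (@no_long_tail a b c d x y z u L) => //.
  split_notin; rewrite /= !inE !negb_or -!andbA; repeat (apply/andP; split); solve [done | neq].
have [z [u [defK xz xu zu]]] := triple_others (A3 KA) xK.
have [zK uK] : z \in K /\ u \in K by rewrite defK !simp.
have [L LA /andP[LK /orP[zL|uL]]] := few_private KA zK uK zu; first exact: (long z u L).
by apply: (long u z L); rewrite // 1?tripleAC // eq_sym.
Qed.

(** Let d be the free vertex of Y. If d lies in Z, or in another member K, one of the four
    configurations with both free vertices covered appears, according to how Z and K meet. If d is
    private, [few_private] applied to the other two vertices of Z prolongs the path, and [no_tail]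
    excludes this. *)
Lemma no_pair X Y Z a b c : X \in A -> Y \in A -> X != Y -> Z \in A -> Z != X ->
  a != b -> a != c -> b != c -> a \in X -> b \in X -> c \in X -> a \in Y -> b \in Y -> c \in Z ->
  False.
Proof.
move=> XA YA XY ZA ZX ab ac bc aX bX cX aY bY cZ.
have [c' [defX ac' bc']] := triple_third (A3 XA) aX bX ab.
have eq_c : c = c'.
  by move: cX; rewrite defX in_triple !(eq_sym c) (negbTE ac) (negbTE bc) /= => /eqP.
have [d [defY ad bd]] := triple_third (A3 YA) aY bY ab; subst.
have cd : c' != d by apply: contraNneq XY => ->.
have XZ : triple a b c' != Z by rewrite eq_sym.
have YZ : triple a b d != Z.
  rewrite eq_sym; apply: (mem_neq cZ); rewrite in_triple !negb_or; apply/and3P; split; neq.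
have aZ : a \notin Z by apply: (notin_third XA YA).
have bZ : b \notin Z by apply: (notin_third XA YA).
have [dZ|dZ] := boolP (d \in Z); first exact: (@no_pair_bridge a b c' d Z).
have [/hasP[K KA /andP[KY dK]]|no_K] := boolP (has (fun K => (K != triple a b d) && (d \in K)) A).
  have YK : triple a b d != K by rewrite eq_sym.
  have dX : d \notin triple a b c' by rewrite in_triple !negb_or; apply/and3P; split; neq.
  have XK : triple a b c' != K by rewrite eq_sym (mem_neq dK dX).
  have ZK : Z != K by rewrite eq_sym (mem_neq dK dZ).
  have aK : a \notin K by apply: (notin_third XA YA).
  have bK : b \notin K by apply: (notin_third XA YA).
  have cK : c' \notin K by apply: (notin_third XA ZA).
  (* Here [x1] stands for whichever further vertex of Z also lies in K; a second common vertex leads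
     to [pair_pair]. *)
  have wedge x1 y1 : Z = triple c' x1 y1 -> c' != x1 -> c' != y1 -> x1 != y1 -> x1 \in K -> False.
    move=> defZ1 cx1 cy1 xy1 xK; have dx : d != x1.
      by apply: contraNneq dZ => ->; rewrite defZ1 in_triple eqxx orbT.
    have [z [defK dz xz]] := triple_third (A3 KA) dK xK dx; subst K Z.
    have [eq_yz|yz] := eqVneq y1 z.
      subst; found avoid pair_pair_verified [:: a; b; c'; d; x1; z].
    found avoid pair_wedge_verified [:: a; b; c'; d; x1; y1; z].
  have [x [y [defZ cx cy xy]]] := triple_others (A3 ZA) cZ.
  have [xK|xK] := boolP (x \in K); first exact: (wedge x y).
  have [yK|yK] := boolP (y \in K).
    by apply: (wedge y x); rewrite // 1?tripleAC // eq_sym.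
  have [z [u [defK dz du zu]]] := triple_others (A3 KA) dK; subst K Z.
  found avoid pair_two_pendants_verified [:: a; b; c'; d; x; y; z; u].
have d_private W : W \in A -> d \in W -> W = triple a b d.
  by move=> WA dW; have := hasPn no_K _ WA; rewrite dW andbT negbK => /eqP.
have [x [y [defZ cx cy xy]]] := triple_others (A3 ZA) cZ.
have [xZ yZ] : x \in Z /\ y \in Z by rewrite defZ !in_triple !eqxx !orbT.
subst Z; split_notin.
have [K KA /andP[KZ /orP[xK|yK]]] := few_private ZA xZ yZ xy.
  apply: (@no_tail a b c' d x y K) => //; rewrite /= !inE !negb_or -!andbA.
  by repeat (apply/andP; split); solve [done | neq].
apply: (@no_tail a b c' d y x K) => //; try by rewrite tripleAC.
rewrite /= !inE !negb_or -!andbA.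
by repeat (apply/andP; split); solve [done | neq].
Qed.

(** Otherwise each vertex of e lies in another member. If one of these contains two vertices of e,
    it contradicts [no_pair] together with the member at the third vertex; if none does, e is a
    centre and [no_center] applies. *)
Lemma exists_private e : e \in A ->
  has (fun y => all (fun f : {fset nat} => (y \in f) ==> (f == e)) A) e.
Proof.
move=> eA; apply: contraT => /hasPn no_private.
have shared y : y \in e -> exists f, [/\ f \in A, f != e & y \in f].
  move=> /no_private /allPn[f fA]; rewrite negb_imply => /andP[yf fe].
  by exists f.
have [a ae] : exists a, a \in e.
  by apply/fset0Pn; rewrite -cardfs_gt0 A3.
have [b [c [defe ab ac bc]]] := triple_others (A3 eA) ae.
have [be ce] : b \in e /\ c \in e by rewrite defe !in_triple !eqxx !orbT.
have [f [fA fe af]] := shared a ae.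
have [g [gA ge bg]] := shared b be.
have [h [hA he ch]] := shared c ce.
have [ef eg eh] : [/\ e != f, e != g & e != h] by split; rewrite eq_sym.
have [ba ca cb] : [/\ b != a, c != a & c != b] by split; rewrite eq_sym.
exfalso.
have [bf|bf] := boolP (b \in f); first exact: (@no_pair e f h a b c).
have [cf|cf] := boolP (c \in f); first exact: (@no_pair e f g a c b).
have [ag|ag] := boolP (a \in g); first exact: (@no_pair e g h a b c).
have [cg|cg] := boolP (c \in g); first exact: (@no_pair e g f b c a).
have [ah|ah] := boolP (a \in h); first exact: (@no_pair e h g a c b).
have [bh|bh] := boolP (b \in h); first exact: (@no_pair e h f b c a).
by apply: (@no_center a b c f g h) => //; rewrite -defe.
Qed.

(** * Counting incidences, with private vertices counted twice *)

Definition private (y : nat) : bool := \sum_(e <- A) (y \in e) == 1.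

Lemma sum_mem y : \sum_(e <- A) (y \in e) + private y <= 2.
Proof.
rewrite leqNgt; apply/negP => deg_gt.
(* The extra unit occurs only at degree one, where the total is 2, so a total above 2 forces degree
   at least three. Three members through y are then peeled off one by one. *)
have : 2 < \sum_(e <- A) (y \in e).
  by move: deg_gt; rewrite /private; case: (\sum_(e <- A) (y \in e)) => [|[|[|s]]].
have [/hasP[e eA ye]|no_e] := boolP (has (fun e : {fset nat} => y \in e) A); last first.
  by rewrite big_seq big1 // => e eA; rewrite (negbTE (hasPn no_e _ eA)).
rewrite (big_fsetD1 e) //= ye.
have [/hasP[f fA yf]|no_f] := boolP (has (fun f : {fset nat} => y \in f) (A `\ e)%fset); last first.
  by rewrite big_seq big1 // => f fA; rewrite (negbTE (hasPn no_f _ fA)).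
rewrite (big_fsetD1 f) //= yf.
have [/hasP[g gA yg]|no_g] :=
    boolP (has (fun g : {fset nat} => y \in g) ((A `\ e) `\ f)%fset); last first.
  by rewrite big_seq big1 // => g gA; rewrite (negbTE (hasPn no_g _ gA)).
move: fA gA; rewrite !inE => /andP[fe fA] /and3P[gf ge gA] _.
by apply: (@degree_le2 e f g y); rewrite // eq_sym.
Qed.

(** An incidence (y, e) has weight 2 if y is private and 1 otherwise. A member collects at least 3 +
    1 by [exists_private], and a vertex spends at most 2 by [sum_mem]. *)
Lemma card_le_half : 2 * #|` A| <= #|` Ufam A|.
Proof.
have sum_e e (F : nat -> nat) : e \in A ->
    \sum_(y <- Ufam A) (y \in e) * F y = \sum_(y <- e) F y.
  move=> eA; rewrite [RHS](_ : _ = \sum_(y <- e) (y \in e) * F y); last first.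
    by apply: eq_big_seq => y ->; rewrite mul1n.
  symmetry; apply: big_fset_incl => [|y _ /negbTE-> //].
  by apply/fsubsetP => y ye; apply/UfamP; exists e.
have private_e e : e \in A -> 1 <= \sum_(y <- e) private y.
  move=> eA; have /hasP[y ye /allP y_priv] := exists_private eA.
  rewrite (big_fsetD1 y) //= /private (big_fsetD1 e) //= ye big_seq big1 // => f.
  by rewrite !inE => /andP[fe fA]; have := y_priv _ fA; rewrite (negbTE fe) implybF => /negbTE->.
have : \sum_(y <- Ufam A) \sum_(e <- A) (y \in e) * (1 + private y) <= \sum_(y <- Ufam A) 2.
  (* The degree times [private y] equals [private y], since the degree is 1 whenever that term is
     nonzero. *)
  apply: leq_sum => y _; rewrite -big_distrl /= mulnDr muln1.
  by have := sum_mem y; rewrite /private; case: eqP => [->|_]; rewrite ?muln0.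
rewrite exchange_big /= [X in _ <= X](_ : _ = 2 * #|` Ufam A|); last first.
  by rewrite card_fset_sum1 big_distrr.
have : \sum_(e <- A) 4 <= \sum_(e <- A) \sum_(y <- Ufam A) (y \in e) * (1 + private y).
  rewrite big_seq [X in _ <= X]big_seq; apply: leq_sum => e eA.
  rewrite sum_e // big_split /= -card_fset_sum1 A3 //.
  exact: (leq_add (leqnn 3) (private_e e eA)).
have -> : \sum_(e <- A) 4 = 4 * #|` A| by rewrite card_fset_sum1 big_distrr.
by move=> le_sum /(leq_trans le_sum); rewrite -[4]/(2 * 2) -mulnA leq_pmul2l.
Qed.
End NoConfiguration.

(** Induction on the size. Deleting a member with two private vertices lowers 2 |A| by 2 and the
    union by at least 2, so the bound for the smaller family, which still avoids the configurations,
    suffices. When no such member exists, the double counting applies. *)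
Lemma avoiding_card_le_half (A : fam) : (forall X, X \in A -> #|` X| = 3) ->
  (forall c v, verify c -> ~~ embeds A c v) -> 2 * #|` A| <= #|` Ufam A|.
Proof.
have [m] := ubnP #|` A|; elim: m A => // m IH A le_m A3 avoid.
pose lone e p q := [&& p != q & all (fun f : {fset nat} => (f == e) || (p \notin f) && (q \notin f)) A].
have [/hasP[e eA /hasP[p pe /hasP[q qe /andP[pq /allP lone_pq]]]]|no_lone] :=
    boolP (has (fun e : {fset nat} => has (fun p => has (lone e p) e) e) A).
  set B := (A `\ e)%fset.
  have cardA : #|` A| = #|` B|.+1 by rewrite (cardfsD1 e) eA.
  have subB X : X \in B -> X \in A by rewrite !inE => /andP[].
  have leB : 2 * #|` B| <= #|` Ufam B|.
    apply: IH => [|X /subB /A3 //|c v c_ok]; first by rewrite -ltnS -cardA.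
    apply: contra (avoid c v c_ok) => /and3P[uv sv /allP inB]; apply/and3P; split=> //.
    by apply/allP => t /inB /subB.
  suff : 2 + #|` Ufam B| <= #|` Ufam A| by rewrite cardA; lia.
  have UA y : y \in e -> y \in Ufam A by move=> ye; apply/UfamP; exists e.
  rewrite (cardfsD1 p (Ufam A)) UA // (cardfsD1 q (Ufam A `\ p)%fset).
  (* The vertices p and q lie in the union of A, while every vertex of the union of B differs from
     both. *)
  rewrite !inE (eq_sym q) pq UA // addnA leq_add2l; apply: fsubset_leq_card.
  apply/fsubsetP => y /UfamP[f]; rewrite !inE => /andP[fe fA] yf.
  have := lone_pq _ fA; rewrite (negbTE fe) /= => /andP[pf qf].
  rewrite (contraNneq _ qf) ?(contraNneq _ pf) //=; try by move=> <-.
  by apply/UfamP; exists f.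
(* The failure of [lone] for all pairs is the hypothesis [few_private]. *)
apply: card_le_half => // X p q XA pX qX pq.
have /allPn[Y YA] : ~~ all (fun f : {fset nat} => (f == X) || (p \notin f) && (q \notin f)) A.
  by have := hasPn (hasPn (hasPn no_lone _ XA) _ pX) _ qX; rewrite /lone pq.
by rewrite negb_or negb_and !negbK => YX; exists Y.
Qed.

Theorem theorem12 (n k : nat) : 4 <= n -> NFC_prop 3 n k -> 2 * k <= n.
Proof.
move=> _ [[A [<- A3 UA notFC]] _].
have <- : #|` Ufam A| = n.
  by rewrite UA card_fseq undup_id ?iota_uniq // size_iota.
(* A configuration inside A would make the generated family FC, against the choice of A. *)
apply: avoiding_card_le_half => // c v c_ok; apply/negP => emb.
exact/notFC/(FC_embeds c_ok emb).
Qed.
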